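(* Let $(H,r)$ be a countable (i.e. countably infinite) locally standard Hamming space. Then there exists a sequence of prime numbers $p_1,p_2,\ldots$ (not necessarily distinct) such that $H\cong \bigotimes_{i=1}^{\infty} H_{p_i}$ as Hamming spaces, where $H_{p_i}$ is the standard Hamming space of length $p_i$.
   Context: A Boolean algebra is a commutative associative algebra over $\mathbb{Z}/2\mathbb{Z}$ satisfying the identity $x^2=x$. A (unital) Hamming space $(H,r)$ is a Boolean algebra $H$ with $1$ together with a ''rang'' function $r:H\to[0,1]$ such that (1) $r(a)=0$ iff $a=0$; (2) $r(a)=1$ iff $a=1$; (3) if $a,b\in H$ and $ab=0$ then $r(a+b)=r(a)+r(b)$. An isomorphism of Hamming spaces is an isomorphism of unital Boolean algebras preserving the rang functions. A subspace of $H$ is a subalgebra containing $1$ equipped with the restriction of $r$. The standard Hamming space $H_n$ ($n\ge 1$) is $(\mathbb{Z}/2\mathbb{Z})^n$ with coordinatewise operations and $r_{H_n}(x_1,\ldots,x_n)=\frac1n(x_1+\cdots+x_n)$ (sum of the $x_i\in\{0,1\}$ taken in $\mathbb{R}$). A Hamming space $H$ is locally standard if every finite collection of elements $a_1,\ldots,a_n\in H$ is contained in a subspace $H'\subset H$ isomorphic to $H_m$ for some $m\ge1$. The tensor product of Hamming spaces $(H',r')$, $(H'',r'')$ is the Boolean algebra $H'\otimes_{\mathbb{Z}}H''$ with the unique rang function $r$ satisfying $r(a\otimes b)=r'(a)r''(b)$. The infinite tensor product $\bigotimes_{i=1}^\infty H_{p_i}$ is the direct limit of the finite tensor products $H_{p_1}\otimes\cdots\otimes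 H_{p_k}$ along the (rang-preserving) embeddings $a\mapsto a\otimes 1$, with the induced rang function. *)

(* Defs.v *)
From HB Require Import structures.
From mathcomp Require Import all_boot all_order all_algebra generic_quotient.
From mathcomp Require Import ring.
From mathcomp Require Import boolp classical_sets functions cardinality reals.

Set Implicit Arguments.
Unset Strict Implicit.
Unset Printing Implicit Defensive.

Import Order.TTheory GRing.Theory Num.Theory.
Local Open Scope ring_scope.
Local Open Scope quotient_scope.

(* Boolean algebras are unital here; comAlgType moreover excludes the zero
   algebra, which carries no rang function since rang 0 = 0 and rang 1 = 1. *)
HB.mixin Record ComAlgebra_isBoolean H of GRing.ComAlgebra 'F_2 H := {
  mulbb : forall x : H, x * x = x
}.

#[short(type="boolAlgType")]
HB.structure Definition BooleanAlgebra :=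
  { H of GRing.ComAlgebra 'F_2 H & ComAlgebra_isBoolean H }.

(* A nontrivial ring in which x * x = x has characteristic 2, and hence a
   unique structure of algebra over 'F_2. *)
HB.factory Record ComPzRing_isBoolean H of GRing.ComPzRing H := {
  one_neq0 : (1 : H) != 0;
  mulbb : forall x : H, x * x = x
}.

HB.builders Context H of ComPzRing_isBoolean H.

HB.instance Definition _ := GRing.PzSemiRing_isNonZero.Build H one_neq0.

Let addbb (x : H) : x + x = 0.
Proof.
have := mulbb (x + x); rewrite mulrDl mulrDr mulbb => /eqP.
by rewrite -subr_eq0 addrK => /eqP.
Qed.

Let mulr2n_mod (x : H) n : x *+ (n %% 2) = x *+ n.
Proof.
rewrite [in RHS](divn_eq n 2) mulrnDr mulnC mulrnA mulr2n addbb mul0rn.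
by rewrite add0r.
Qed.

Let scale (c : 'F_2) (x : H) : H := x *+ (c : nat).

Let scaleA a b v : scale a (scale b v) = scale (a * b) v.
Proof. by rewrite /scale -mulrnA mulr2n_mod mulnC. Qed.

Let scale1 : left_id 1 scale. Proof. by move=> v. Qed.

Let scaleDr : right_distributive scale +%R.
Proof. by move=> c u v; rewrite /scale mulrnDl. Qed.

Let scaleDl v : {morph scale^~ v : a b / a + b}.
Proof. by move=> a b; rewrite /scale mulr2n_mod mulrnDr. Qed.

HB.instance Definition _ :=
  GRing.Zmodule_isLmodule.Build 'F_2 H scaleA scale1 scaleDr scaleDl.

Let scaleAl (c : 'F_2) (x y : H) : c *: (x * y) = (c *: x) * y.
Proof. by rewrite /GRing.scale /= /scale mulrnAl. Qed.

HB.instance Definition _ := GRing.Lmodule_isLalgebra.Build 'F_2 H scaleAl.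
HB.instance Definition _ := GRing.Lalgebra_isComAlgebra.Build 'F_2 H.
HB.instance Definition _ := ComAlgebra_isBoolean.Build H mulbb.

HB.end.

HB.mixin Record BooleanAlgebra_isHamming (R : realType) H
    of BooleanAlgebra H := {
  rang : H -> R;
  rang_itv : forall a, 0 <= rang a <= 1;
  rang_eq0 : forall a, rang a = 0 <-> a = 0;
  rang_eq1 : forall a, rang a = 1 <-> a = 1;
  rangD : forall a b, a * b = 0 -> rang (a + b) = rang a + rang b
}.

#[short(type="hammingType")]
HB.structure Definition Hamming (R : realType) :=
  { H of BooleanAlgebra H & BooleanAlgebra_isHamming R H }.

HB.factory Record BooleanAlgebra_hasRang (R : realType) H
    of BooleanAlgebra H := {
  rang : H -> R;
  rang_ge0 : forall a, 0 <= rang a;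
  rang_eq0P : forall a, rang a = 0 -> a = 0;
  rang1 : rang 1 = 1;
  rangD : forall a b, a * b = 0 -> rang (a + b) = rang a + rang b
}.

HB.builders Context R H of BooleanAlgebra_hasRang R H.

Let rang0 : rang 0 = 0.
Proof.
have := @rangD 0 0 (mulr0 _); rewrite addr0 => /eqP.
by rewrite eq_sym -subr_eq0 addrK => /eqP.
Qed.

Let rangC a : rang a + rang (1 - a) = 1.
Proof. by rewrite -rangD ?subrKC ?rang1// mulrBr mulr1 mulbb subrr. Qed.

Let rang_itv a : 0 <= rang a <= 1.
Proof. by rewrite rang_ge0 /= -(rangC a) lerDl rang_ge0. Qed.

Let rang_eq0 a : rang a = 0 <-> a = 0.
Proof. by split=> [/rang_eq0P//|->]. Qed.

Let rang_eq1 a : rang a = 1 <-> a = 1.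
Proof.
split=> [a1|->]; last exact: rang1.
have /eqP := rangC a; rewrite a1 -subr_eq0 addrC addKr => /eqP /rang_eq0P /eqP.
by rewrite subr_eq0 => /eqP.
Qed.

HB.instance Definition _ :=
  BooleanAlgebra_isHamming.Build R H rang_itv rang_eq0 rang_eq1 rangD.

HB.end.

Lemma additive_scalable (A B : boolAlgType) (f : {additive A -> B}) :
  scalable f.
Proof.
by move=> c x; rewrite -[c](@natr_Zp 0) !scaler_nat raddfMn.
Qed.

Record hamming_embedding (R : realType) (A B : hammingType R) := {
  hamming_fun :> {lrmorphism A -> B};
  hamming_funE : forall x, rang (hamming_fun x) = rang x :> R
}.

Definition hamming_iso (R : realType) (A B : hammingType R) : Prop :=
  exists f : hamming_embedding A B, bijective f.

Section HammingTheory.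
Variables (R : realType) (H : hammingType R).
Implicit Types a b e : H.

Lemma addbb a : a + a = 0.
Proof.
have := mulbb (a + a); rewrite mulrDl mulrDr mulbb => /eqP.
by rewrite -subr_eq0 addrK => /eqP.
Qed.

Lemma oppb a : - a = a.
Proof. by apply/eqP; rewrite eq_sym -subr_eq0 opprK addbb. Qed.

Lemma rang0 : rang (0 : H) = 0 :> R. Proof. exact/rang_eq0. Qed.

Lemma rang1 : rang (1 : H) = 1 :> R. Proof. exact/rang_eq1. Qed.

Lemma rang_ge0 a : 0 <= rang a :> R.
Proof. by case/andP: (rang_itv (s := H) a). Qed.

Lemma rang_split a e : rang e = rang (e * a) + rang (e * (1 - a)) :> R.
Proof.
rewrite -rangD; first by rewrite -mulrDr subrKC mulr1.
by rewrite mulrACA mulrBr mulr1 !mulbb subrr mulr0.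
Qed.

End HammingTheory.

Section HammingEmbeddingTheory.
Variables (R : realType) (A B : hammingType R) (f : hamming_embedding A B).

Lemma hamming_embedding_inj : injective f.
Proof.
move=> x y fxy; apply/eqP; rewrite -subr_eq0; apply/eqP/(rang_eq0 (s := A)).
by rewrite -(hamming_funE f) raddfB /= fxy subrr rang0.
Qed.

End HammingEmbeddingTheory.

Definition std_hamming n of (0 < n)%N : Type := {ffun 'I_n -> 'F_2}.

Section Standard.
Variables (R : realType) (n : nat) (n_gt0 : (0 < n)%N).
Local Notation H := (std_hamming n_gt0).

HB.instance Definition _ := GRing.PzRing.on H.

Let std_mulC : commutative (@GRing.mul H).
Proof. by move=> x y; apply/ffunP => i; rewrite !ffunE mulrC. Qed.

HB.instance Definition _ := GRing.PzRing_hasCommutativeMul.Build H std_mulC.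

Let std_one_neq0 : (1 : H) != 0.
Proof. by apply/eqP => /ffunP /(_ (Ordinal n_gt0)); rewrite !ffunE. Qed.

Let F2_mulbb (c : 'F_2) : c * c = c.
Proof. by case: c => -[|[|//]] ?; apply/val_inj. Qed.

Let std_mulbb (x : H) : x * x = x.
Proof. by apply/ffunP => i; rewrite ffunE F2_mulbb. Qed.

HB.instance Definition _ := ComPzRing_isBoolean.Build H std_one_neq0 std_mulbb.

Definition std_rang (x : H) : R := n%:R^-1 * \sum_i (x i : nat)%:R.

Let std_rang_ge0 x : 0 <= std_rang x.
Proof. by rewrite mulr_ge0 ?invr_ge0 ?ler0n ?sumr_ge0// => i _. Qed.

Let n_neq0 : n%:R != 0 :> R.
Proof. by rewrite pnatr_eq0 -lt0n. Qed.

Let std_rang_eq0 x : std_rang x = 0 -> x = 0.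
Proof.
move=> /eqP; rewrite mulf_eq0 invr_eq0 (negPf n_neq0) /=.
rewrite psumr_eq0 => [/allP x0|//]; apply/ffunP => i; rewrite ffunE.
by apply/val_inj/eqP; have := x0 i (mem_index_enum i); rewrite pnatr_eq0.
Qed.

Let std_rang1 : std_rang 1 = 1.
Proof.
rewrite /std_rang (eq_bigr (fun=> 1)) => [|i _]; last by rewrite ffunE.
by rewrite sumr_const card_ord mulVf.
Qed.

Let F2_addn (c d : 'F_2) : c * d = 0 -> (c + d : 'F_2) = (c + d)%N :> nat.
Proof. by move: c d => -[[|[|//]] ?] -[[|[|//]] ?]. Qed.

Let std_rangD x y : x * y = 0 -> std_rang (x + y) = std_rang x + std_rang y.
Proof.
move=> /ffunP xy0; rewrite /std_rang -mulrDr -big_split /=; congr (_ * _).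
apply: eq_bigr => i _; rewrite -natrD ffunE F2_addn//.
by have := xy0 i; rewrite !ffunE.
Qed.

HB.instance Definition _ := BooleanAlgebra_hasRang.Build R H
  std_rang_ge0 std_rang_eq0 std_rang1 std_rangD.

End Standard.

Definition hamming_subspace (R : realType) (H : hammingType R)
  (S : subalgClosed H) : Type := {x : H | x \in S}.

Section Subspace.
Variables (R : realType) (H : hammingType R) (S : subalgClosed H).
Local Notation sub := (hamming_subspace S).

HB.instance Definition _ := SubChoice.on sub.
HB.instance Definition _ := [SubChoice_isSubAlgebra of sub by <:].
HB.instance Definition _ := [SubNzRing_isSubComNzRing of sub by <:].

Let sub_mulbb (x : sub) : x * x = x.
Proof. by apply/val_inj; rewrite rmorphM /= mulbb. Qed.

HB.instance Definition _ := ComAlgebra_isBoolean.Build sub sub_mulbb.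

Definition sub_rang (x : sub) : R := rang (val x).

Let sub_rang_ge0 x : 0 <= sub_rang x. Proof. exact: rang_ge0. Qed.

Let sub_rang_eq0 x : sub_rang x = 0 -> x = 0.
Proof. by move=> /rang_eq0 x0; apply/val_inj; rewrite rmorph0. Qed.

Let sub_rang1 : sub_rang 1 = 1.
Proof. by rewrite /sub_rang rmorph1 rang1. Qed.

Let sub_rangD x y : x * y = 0 -> sub_rang (x + y) = sub_rang x + sub_rang y.
Proof.
move=> /(congr1 val); rewrite rmorphM rmorph0 => xy0.
by rewrite /sub_rang rmorphD; exact: rangD.
Qed.

HB.instance Definition _ := BooleanAlgebra_hasRang.Build R sub
  sub_rang_ge0 sub_rang_eq0 sub_rang1 sub_rangD.

End Subspace.

Definition locally_standard (R : realType) (H : hammingType R) : Prop :=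
  forall s : seq H, exists S : subalgClosed H,
    {subset s <= S} /\
    exists m, exists m_gt0 : (0 < m)%N,
      hamming_iso (hamming_subspace S) (std_hamming m_gt0).

(* A \otimes_Z B is presented by the generators a \otimes b and the relations
   of bilinearity; a word is the list of the summands a \otimes b of a formal
   sum.  Words without signs suffice since - (a \otimes b) = (- a) \otimes b. *)
Section TensorZmodule.
Variables A B : zmodType.
Implicit Types s t u : seq (A * B).

Inductive tensor_eq : seq (A * B) -> seq (A * B) -> Prop :=
| tensor_refl s : tensor_eq s s
| tensor_sym s t : tensor_eq s t -> tensor_eq t s
| tensor_trans s t u : tensor_eq s t -> tensor_eq t u -> tensor_eq s u
| tensor_cat s s' t t' :
    tensor_eq s s' -> tensor_eq t t' -> tensor_eq (s ++ t) (s' ++ t')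
| tensor_catC s t : tensor_eq (s ++ t) (t ++ s)
| tensor_0l b : tensor_eq [:: (0, b)] [::]
| tensor_0r a : tensor_eq [:: (a, 0)] [::]
| tensor_Dl a a' b : tensor_eq [:: (a + a', b)] [:: (a, b); (a', b)]
| tensor_Dr a b b' : tensor_eq [:: (a, b + b')] [:: (a, b); (a, b')].

Definition tensor_rel : rel (seq (A * B)) := fun s t => `[< tensor_eq s t >].

Let tensor_rel_refl : reflexive tensor_rel.
Proof. by move=> s; apply/asboolP/tensor_refl. Qed.

Let tensor_rel_sym : symmetric tensor_rel.
Proof. by move=> s t; apply/asboolP/asboolP; exact: tensor_sym. Qed.

Let tensor_rel_trans : transitive tensor_rel.
Proof.
by move=> t s u /asboolP st /asboolP tu; apply/asboolP/(tensor_trans st tu).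
Qed.

Canonical tensor_equiv :=
  EquivRel tensor_rel tensor_rel_refl tensor_rel_sym tensor_rel_trans.

Definition tensor : Type := {eq_quot tensor_rel}.

HB.instance Definition _ := Choice.on tensor.
HB.instance Definition _ := EqQuotient.on tensor.

Lemma tensor_piE s t : \pi_tensor s = \pi_tensor t <-> tensor_eq s t.
Proof. by split=> [/eqmodP/asboolP|st]; last exact/eqmodP/asboolP. Qed.

Lemma tensorW (P : tensor -> Prop) :
  (forall s, P (\pi_tensor s)) -> forall x, P x.
Proof. by move=> Ppi x; rewrite -[x]reprK. Qed.

Lemma tensor_piK s : tensor_eq (repr (\pi_tensor s)) s.
Proof. by apply/tensor_piE; rewrite reprK. Qed.

Definition tensor_pure (a : A) (b : B) : tensor := \pi_tensor [:: (a, b)].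

Definition tensor_zero : tensor := \pi_tensor [::].
Definition tensor_add (x y : tensor) : tensor := \pi_tensor (repr x ++ repr y).
Definition tensor_opp (x : tensor) : tensor :=
  \pi_tensor [seq (- p.1, p.2) | p <- repr x].

Let addE s t : tensor_add (\pi_tensor s) (\pi_tensor t) = \pi_tensor (s ++ t).
Proof. by apply/tensor_piE/tensor_cat; exact: tensor_piK. Qed.

Let tensor_addA : associative tensor_add.
Proof.
move=> x y z.
elim/tensorW: x => s; elim/tensorW: y => t; elim/tensorW: z => u.
by rewrite !addE catA.
Qed.

Let tensor_addC : commutative tensor_add.
Proof.
move=> x y; elim/tensorW: x => s; elim/tensorW: y => t; rewrite !addE.
by apply/tensor_piE; exact: tensor_catC.
Qed.

Let tensor_add0 : left_id tensor_zero tensor_add.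
Proof. by move=> x; elim/tensorW: x => s; rewrite addE. Qed.

Let tensor_addN : left_inverse tensor_zero tensor_opp tensor_add.
Proof.
move=> x; elim/tensorW: x => s; rewrite -[X in tensor_add _ X]reprK addE.
apply/tensor_piE.
elim: (repr _) => [|[a b] r IHr] /=; first exact: tensor_refl.
set r' := map _ r in IHr *.
rewrite -[(- a, b) :: _]/((_ :: r') ++ [:: (a, b)] ++ r) catA.
have catC : tensor_eq (((- a, b) :: r') ++ [:: (a, b)])
                      ([:: (- a, b); (a, b)] ++ r').
  by apply: (tensor_cat (tensor_refl [:: (- a, b)])); exact: tensor_catC.
apply: tensor_trans (tensor_cat catC (tensor_refl r)) _.
rewrite -catA; apply: (@tensor_cat _ [::] _ [::]) IHr.
apply: tensor_trans (tensor_sym (tensor_Dl _ _ _)) _.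
by rewrite addNr; exact: tensor_0l.
Qed.

HB.instance Definition _ := GRing.isZmodule.Build tensor
  tensor_addA tensor_addC tensor_add0 tensor_addN.

Lemma tensor_pi_sum s : \pi_tensor s = \sum_(p <- s) tensor_pure p.1 p.2.
Proof.
elim: s => [|[a b] s IHs]; first by rewrite big_nil.
by rewrite big_cons -IHs -cat1s -addE.
Qed.

Lemma tensor_sumE (x : tensor) :
  x = \sum_(p <- repr x) tensor_pure p.1 p.2.
Proof. by rewrite -tensor_pi_sum reprK. Qed.

Lemma tensor_pureDl a a' b :
  tensor_pure (a + a') b = tensor_pure a b + tensor_pure a' b.
Proof.
by rewrite [RHS]addE; apply/tensor_piE; exact: tensor_Dl.
Qed.

Lemma tensor_pureDr a b b' :
  tensor_pure a (b + b') = tensor_pure a b + tensor_pure a b'.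
Proof.
by rewrite [RHS]addE; apply/tensor_piE; exact: tensor_Dr.
Qed.

Lemma tensor_pure0l b : tensor_pure 0 b = 0.
Proof. by apply/tensor_piE; exact: tensor_0l. Qed.

Lemma tensor_pure0r a : tensor_pure a 0 = 0.
Proof. by apply/tensor_piE; exact: tensor_0r. Qed.

(* The universal property of the tensor product. *)
Section Lift.
Variables (M : zmodType) (f : A -> B -> M).
Hypothesis fDl : forall a a' b, f (a + a') b = f a b + f a' b.
Hypothesis fDr : forall a b b', f a (b + b') = f a b + f a b'.

Definition tensor_lift (x : tensor) : M := \sum_(p <- repr x) f p.1 p.2.

Lemma tensor_lift_pi s : tensor_lift (\pi_tensor s) = \sum_(p <- s) f p.1 p.2.
Proof.
have f0l b : f 0 b = 0.
  by have /eqP := fDl 0 0 b; rewrite addr0 eq_sym -subr_eq0 addrK => /eqP.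
have f0r a : f a 0 = 0.
  by have /eqP := fDr a 0 0; rewrite addr0 eq_sym -subr_eq0 addrK => /eqP.
rewrite /tensor_lift; have := tensor_piK s; move: (repr _) => r.
elim=> {r s} //.
- by move=> s t u _ -> _ ->.
- by move=> s s' t t' _ ss' _ tt'; rewrite !big_cat /= ss' tt'.
- by move=> s t; rewrite !big_cat /= addrC.
- by move=> b; rewrite big_seq1 big_nil f0l.
- by move=> a; rewrite big_seq1 big_nil f0r.
- by move=> a a' b; rewrite !big_cons !big_nil !addr0 fDl.
- by move=> a b b'; rewrite !big_cons !big_nil !addr0 fDr.
Qed.

Lemma tensor_lift_pure a b : tensor_lift (tensor_pure a b) = f a b.
Proof. by rewrite tensor_lift_pi big_seq1. Qed.

Lemma tensor_liftD : {morph tensor_lift : x y / x + y}.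
Proof.
move=> x y; elim/tensorW: x => s; elim/tensorW: y => t.
by rewrite [_ + _]addE !tensor_lift_pi big_cat.
Qed.

End Lift.

End TensorZmodule.

Arguments tensor_pure {A B}.

Section TensorRing.
Variables A B : comPzRingType.
Local Notation T := (tensor A B).
Implicit Types x y z : T.

Definition tensor_one : T := tensor_pure 1 1.
Definition tensor_mul x y : T := \sum_(p <- repr x) \sum_(q <- repr y)
  tensor_pure (p.1 * q.1) (p.2 * q.2).

Let mul_pi x s :
  tensor_mul x (\pi_T s) = \sum_(p <- repr x) \sum_(q <- s)
    tensor_pure (p.1 * q.1) (p.2 * q.2).
Proof.
apply: eq_bigr => -[a b] _; apply: (@tensor_lift_pi _ _ _
  (fun a' b' => tensor_pure (a * a') (b * b'))).
  by move=> *; rewrite mulrDr tensor_pureDl.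
by move=> *; rewrite mulrDr tensor_pureDr.
Qed.

Let tensor_mulC : commutative tensor_mul.
Proof.
move=> x y; rewrite /tensor_mul exchange_big; apply: eq_bigr => p _.
by apply: eq_bigr => q _; rewrite (mulrC p.1) (mulrC p.2).
Qed.

Lemma tensor_mul_pi s t :
  tensor_mul (\pi_T s) (\pi_T t) = \sum_(p <- s) \sum_(q <- t)
    tensor_pure (p.1 * q.1) (p.2 * q.2).
Proof.
rewrite mul_pi exchange_big [RHS]exchange_big; apply: eq_bigr => -[a b] _ /=.
apply: (@tensor_lift_pi _ _ _ (fun a' b' => tensor_pure (a' * a) (b' * b))).
  by move=> *; rewrite mulrDl tensor_pureDl.
by move=> *; rewrite mulrDl tensor_pureDr.
Qed.

Let mul_pure a b a' b' : tensor_mul (tensor_pure a b) (tensor_pure a' b') =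
  tensor_pure (a * a') (b * b').
Proof. by rewrite tensor_mul_pi !big_seq1. Qed.

Let tensor_mulDl : left_distributive tensor_mul +%R.
Proof.
move=> x y z.
elim/tensorW: x => s; elim/tensorW: y => t; elim/tensorW: z => u.
have -> : \pi_T s + \pi_T t = \pi_T (s ++ t).
  by rewrite !tensor_pi_sum big_cat.
by rewrite !tensor_mul_pi big_cat.
Qed.

Let tensor_mulDr : right_distributive tensor_mul +%R.
Proof. by move=> x y z; rewrite !(tensor_mulC x) tensor_mulDl. Qed.

Let mul0l x : tensor_mul 0 x = 0.
Proof.
have /eqP := tensor_mulDl 0 0 x.
by rewrite addr0 eq_sym -subr_eq0 addrK => /eqP.
Qed.

Let mul_suml I (r : seq I) (F : I -> T) x :
  tensor_mul (\sum_(i <- r) F i) x = \sum_(i <- r) tensor_mul (F i) x.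
Proof.
by apply: (big_morph (tensor_mul^~ x) (fun y z => tensor_mulDl y z x)).
Qed.

Let mul_sumr I (r : seq I) (F : I -> T) x :
  tensor_mul x (\sum_(i <- r) F i) = \sum_(i <- r) tensor_mul x (F i).
Proof.
by rewrite tensor_mulC mul_suml; apply: eq_bigr => i _; rewrite tensor_mulC.
Qed.

Let tensor_mulA : associative tensor_mul.
Proof.
move=> x y z; rewrite (tensor_sumE x) !mul_suml; apply: eq_bigr => p _.
rewrite (tensor_sumE y) mul_suml !mul_sumr mul_suml; apply: eq_bigr => q _.
rewrite (tensor_sumE z) !mul_sumr; apply: eq_bigr => r _.
by rewrite !mul_pure !mulrA.
Qed.

Let tensor_mul1 : left_id tensor_one tensor_mul.
Proof.
move=> x; rewrite {1}(tensor_sumE x) mul_sumr [RHS]tensor_sumE.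
by apply: eq_bigr => p _; rewrite mul_pure !mul1r.
Qed.

HB.instance Definition _ := GRing.Zmodule_isComPzRing.Build T
  tensor_mulA tensor_mulC tensor_mul1 tensor_mulDl.

Lemma tensor_pureM a a' b b' : tensor_pure (a * a') (b * b') =
  tensor_pure a b * tensor_pure a' b' :> T.
Proof. by rewrite [RHS]mul_pure. Qed.

Lemma tensor_pure1 : tensor_pure 1 1 = 1 :> T. Proof. by []. Qed.

End TensorRing.

(* disjoint_split e b s writes e \otimes b + \sum_(p <- s) e * p.1 \otimes p.2
   as a sum of pure tensors with pairwise disjoint left factors (for A
   Boolean): for s = (a_i, b_i)_i, disjoint_split 1 0 s consists of the pairs
     (\prod_(i in S) a_i * \prod_(i notin S) (1 - a_i), \sum_(i in S) b_i). *)
Fixpoint disjoint_split (A B : comPzRingType) (e : A) (b : B)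
    (s : seq (A * B)) : seq (A * B) :=
  if s is p :: s' then
    disjoint_split (e * p.1) (b + p.2) s' ++ disjoint_split (e * (1 - p.1)) b s'
  else [:: (e, b)].

(* This is the only rang function with rang (a \otimes b) = rang a * rang b,
   see tensor_rang_uniq below. *)
Definition tensor_rang (R : realType) (A B : hammingType R)
    (x : tensor A B) : R :=
  \sum_(p <- disjoint_split 1 0 (repr x)) rang p.1 * rang p.2.

Section TensorHamming.
Variables (R : realType) (A B : hammingType R).
Local Notation T := (tensor A B).
Implicit Types (a e : A) (b : B) (s t : seq (A * B)).

Let W e b s : R := \sum_(p <- disjoint_split e b s) rang p.1 * rang p.2.

Let W_cons e b p s :
  W e b (p :: s) = W (e * p.1) (b + p.2) s + W (e * (1 - p.1)) b s.
Proof. by rewrite /W /= big_cat. Qed.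

Let W_nil e b : W e b [::] = rang e * rang b.
Proof. by rewrite /W big_seq1. Qed.

Let W_cat e b s t :
  W e b (s ++ t) = \sum_(p <- disjoint_split e b s) W p.1 p.2 t.
Proof.
elim: s e b => [|p s IHs] e b /=; first by rewrite big_seq1.
by rewrite W_cons !IHs big_cat.
Qed.

Let W_swap e b p q s : W e b (p :: q :: s) = W e b (q :: p :: s).
Proof.
rewrite !W_cons addrACA; congr (W _ _ _ + W _ _ _ + (W _ _ _ + W _ _ _));
  by [exact: mulrAC | exact: addrAC].
Qed.

Let W_rot e b p s t : W e b (s ++ p :: t) = W e b (p :: s ++ t).
Proof.
elim: s e b => // q s IHs e b; rewrite !cat_cons.
by rewrite W_cons !IHs -W_cons W_swap.
Qed.

Let W_catC e b s t : W e b (s ++ t) = W e b (t ++ s).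
Proof.
elim: s e b => [|p s IHs] e b; first by rewrite cats0.
by rewrite cat_cons W_cons !IHs -W_cons W_rot.
Qed.

Let mulb1B a : a * (1 - a) = 0.
Proof. by rewrite mulrBr mulr1 mulbb subrr. Qed.

Let W_Dl e b a a' b' :
  W e b [:: (a + a', b')] = W e b [:: (a, b'); (a', b')].
Proof.
have E1 : (a + a') * a = a * (1 - a').
  by rewrite mulrDl mulbb mulrBr mulr1 oppb (mulrC a').
have E2 : (a + a') * (1 - a) = (1 - a) * a'.
  by rewrite mulrDl mulb1B add0r mulrC.
have E3 : (1 - (a + a')) * a = a * a'.
  by rewrite mulrBl mul1r E1 mulrBr mulr1 subKr.
have E4 : (1 - (a + a')) * (1 - a) = (1 - a) * (1 - a').
  by rewrite opprD addrA mulrBl mulbb [RHS]mulrBr mulr1 (mulrC a').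
rewrite !W_cons !W_nil /= (rang_split a (e * (a + a'))).
rewrite (rang_split a (e * (1 - _))) -!mulrA E1 E2 E3 E4 -(addrA b) addbb addr0.
by ring.
Qed.

Let W_Dr e b a b1 b2 :
  W e b [:: (a, b1 + b2)] = W e b [:: (a, b1); (a, b2)].
Proof.
rewrite !W_cons !W_nil /= -!mulrA (mulrC (1 - a) a) mulb1B !mulbb mulr0 rang0.
by rewrite !mul0r addr0 add0r addrA.
Qed.

Let W_eq e b s t : tensor_eq s t -> W e b s = W e b t.
Proof.
move=> st; elim: st e b => {s t} //=.
- by move=> s t u _ IHst _ IHtu e b; rewrite IHst IHtu.
- move=> s s' t t' _ IHs _ IHt e b; rewrite W_cat.
  under eq_bigr do rewrite IHt; rewrite -W_cat W_catC W_cat.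
  by under eq_bigr do rewrite IHs; rewrite -W_cat W_catC.
- move=> b' e b; rewrite W_cons !W_nil /= mulr0 rang0 mul0r add0r.
  by rewrite subr0 mulr1.
- by move=> a e b; rewrite W_cons !W_nil /= addr0 -mulrDl -rang_split.
Qed.

Let tensor_rang_pi s : tensor_rang (\pi_T s) = W 1 0 s.
Proof. by apply: W_eq; exact: tensor_piK. Qed.

Lemma tensor_rang_pure a b : tensor_rang (tensor_pure a b) = rang a * rang b.
Proof.
rewrite tensor_rang_pi W_cons !W_nil /=.
by rewrite mul1r add0r rang0 mulr0 addr0.
Qed.

Let pi_cons p s : \pi_T (p :: s) = tensor_pure p.1 p.2 + \pi_T s.
Proof. by rewrite !tensor_pi_sum big_cons. Qed.

Let pure_split a e b :
  tensor_pure e b = tensor_pure (e * a) b + tensor_pure (e * (1 - a)) b :> T.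
Proof. by rewrite -tensor_pureDl -mulrDr subrKC mulr1. Qed.

Let split_sum e b s : \sum_(p <- disjoint_split e b s) tensor_pure p.1 p.2 =
  tensor_pure e 1 * (tensor_pure 1 b + \pi_T s).
Proof.
elim: s e b => [|p s IHs] e b /=.
  rewrite big_seq1 [\pi_T _]tensor_pi_sum big_nil addr0.
  by rewrite -tensor_pureM mulr1 mul1r.
rewrite big_cat !IHs /= pi_cons tensor_pureDr (pure_split p.1 e 1).
rewrite [in RHS]mulrDl; congr (_ + _).
  rewrite -!addrA !mulrDr -!tensor_pureM !mulr1 !mul1r.
  by rewrite -mulrA mulbb.
have := mulb1B p.1; rewrite mulrC; move: (1 - p.1) => c cp.
by rewrite !mulrDr -!tensor_pureM -(mulrA e c p.1) cp mulr0 tensor_pure0l add0r.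
Qed.

Let tensor_mulbb (x : T) : x * x = x.
Proof.
have x2 (y : T) : y + y = 0.
  rewrite -(mul1r y) -mulrDl -tensor_pure1 -tensor_pureDl addbb.
  by rewrite tensor_pure0l mul0r.
elim/tensorW: x; elim=> [|p s IHs].
  by rewrite [\pi_T _]tensor_pi_sum big_nil mulr0.
rewrite pi_cons; set u := tensor_pure _ _; set v := \pi_T s in IHs *.
have uu : u * u = u by rewrite -tensor_pureM !mulbb.
by rewrite mulrDl !mulrDr uu IHs (mulrC v) addrA -(addrA u) x2 addr0.
Qed.

Let tensor_rang1 : tensor_rang (1 : T) = 1.
Proof. by rewrite -tensor_pure1 tensor_rang_pure !rang1 mulr1. Qed.

Let tensor_rang0 : tensor_rang (0 : T) = 0.
Proof.
have -> : 0 = tensor_pure 0 0 :> T by rewrite tensor_pure0l.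
by rewrite tensor_rang_pure !rang0 mulr0.
Qed.

Let tensor_one_neq0 : (1 : T) != 0.
Proof.
apply/eqP => T10; have := tensor_rang1; rewrite T10 tensor_rang0.
by move=> /esym/eqP; rewrite oner_eq0.
Qed.

HB.instance Definition _ :=
  ComPzRing_isBoolean.Build T tensor_one_neq0 tensor_mulbb.

Let tensor_rang_ge0 (x : T) : 0 <= tensor_rang x.
Proof. by apply: sumr_ge0 => p _; rewrite mulr_ge0// rang_ge0. Qed.

Let pure_eq0 a b : rang a * rang b = 0 :> R -> tensor_pure a b = 0 :> T.
Proof.
move=> /eqP; rewrite mulf_eq0 => /orP[] /eqP /rang_eq0 ->.
  by rewrite tensor_pure0l.
by rewrite tensor_pure0r.
Qed.

Let pi_split s : \pi_T s = \sum_(p <- disjoint_split 1 0 s) tensor_pure p.1 p.2.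
Proof. by rewrite split_sum tensor_pure0r add0r mul1r. Qed.

Let tensor_rang_eq0 (x : T) : tensor_rang x = 0 -> x = 0.
Proof.
elim/tensorW: x => s; rewrite tensor_rang_pi pi_split => /eqP.
rewrite psumr_eq0 => [/allP s0|p _]; last by rewrite mulr_ge0// rang_ge0.
by rewrite big_seq big1// => p /s0 /eqP /pure_eq0.
Qed.

Let split_fst e b s p : p \in disjoint_split e b s -> p.1 * e = p.1.
Proof.
elim: s e b => [|q s IHs] e b /=; first by rewrite inE => /eqP->; rewrite mulbb.
have absorb c : p.1 * (e * c) = p.1 -> p.1 * e = p.1.
  by move=> <-; rewrite -mulrA mulrAC mulbb.
by rewrite mem_cat => /orP[] /IHs /absorb.
Qed.

Let split_pure e b s p : p \in disjoint_split e b s ->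
  tensor_pure p.1 1 * (tensor_pure 1 b + \pi_T s) = tensor_pure p.1 p.2.
Proof.
elim: s e b => [|q s IHs] e b /=.
  rewrite inE => /eqP-> /=; rewrite [\pi_T _]tensor_pi_sum big_nil addr0.
  by rewrite -tensor_pureM mulr1 mul1r.
rewrite pi_cons mem_cat => /orP[] ps; have p1 := split_fst ps;
  rewrite -(IHs _ _ ps).
  have pq : p.1 * q.1 = p.1 by rewrite -p1 -!mulrA mulbb.
  rewrite tensor_pureDr -addrA !mulrDr; congr (_ + (_ + _)).
  by rewrite -!tensor_pureM pq mulr1.
have pq : p.1 * q.1 = 0.
  by rewrite -p1 -!mulrA (mulrC (1 - q.1)) mulb1B !mulr0.
by rewrite addrCA mulrDr -tensor_pureM pq tensor_pure0l add0r.
Qed.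

Let split_shift e b c s :
  disjoint_split e (c + b) s = [seq (p.1, c + p.2) | p <- disjoint_split e b s].
Proof. by elim: s e b => //= p s IHs e b; rewrite -addrA !IHs map_cat. Qed.

Let split_rang e b s : \sum_(p <- disjoint_split e b s) rang p.1 = rang e :> R.
Proof.
elim: s e b => [|p s IHs] e b /=; first by rewrite big_seq1.
by rewrite big_cat /= !IHs -rang_split.
Qed.

Let W_refine e b s t : \sum_(p <- disjoint_split e b s) W p.1 0 t = W e 0 t.
Proof.
elim: s e b => [|q s IHs] e b /=; first by rewrite big_seq1.
rewrite big_cat /= !IHs.
have /(W_eq e 0) <- : tensor_eq ([:: (q.1, 0)] ++ t) ([::] ++ t).
  by apply: tensor_cat; [exact: tensor_0r | exact: tensor_refl].
by rewrite W_cons addr0.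
Qed.

Let tensor_rangD (x y : T) :
  x * y = 0 -> tensor_rang (x + y) = tensor_rang x + tensor_rang y.
Proof.
elim/tensorW: x => s; elim/tensorW: y => t st0.
have -> : \pi_T s + \pi_T t = \pi_T (s ++ t).
  by rewrite !tensor_pi_sum big_cat.
rewrite !tensor_rang_pi W_cat -(W_refine 1 0 s t) [W 1 0 s]/W -big_split /=.
apply: eq_big_seq => l ls; rewrite -[in LHS](addr0 l.2) /W split_shift big_map.
rewrite -[in RHS](split_rang l.1 0 t) mulr_suml -big_split /=.
apply: eq_big_seq => m mt; rewrite -mulrDr.
have [->|m1_neq0] := eqVneq m.1 0; first by rewrite rang0 !mul0r.
congr (_ * _); apply: rangD; apply/(@rang_eq0 R).
have : tensor_rang (tensor_pure m.1 (l.2 * m.2)) = 0.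
  suff -> : tensor_pure m.1 (l.2 * m.2) =
      tensor_pure m.1 1 * (\pi_T s * \pi_T t).
    by rewrite st0 mulr0.
  have := split_pure ls; have := split_pure mt.
  rewrite tensor_pure0r !add0r => mE lE.
  have {}lE : tensor_pure m.1 1 * \pi_T s = tensor_pure m.1 l.2.
    rewrite -(split_fst mt) -[1 in LHS]mulr1 tensor_pureM -mulrA lE.
    by rewrite -tensor_pureM mul1r.
  rewrite -{1}(mulbb m.1) tensor_pureM -lE -mE mulrACA -tensor_pureM.
  by rewrite mulbb mulr1.
rewrite tensor_rang_pure => /eqP; rewrite mulf_eq0 => /orP[] /eqP //.
by move=> /rang_eq0 m10; rewrite m10 eqxx in m1_neq0.
Qed.

HB.instance Definition _ := BooleanAlgebra_hasRang.Build R T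
  tensor_rang_ge0 tensor_rang_eq0 tensor_rang1 tensor_rangD.

Lemma tensor_rang_uniq (rho : T -> R) :
    (forall a b, rho (tensor_pure a b) = rang a * rang b) ->
    (forall x y, x * y = 0 -> rho (x + y) = rho x + rho y) ->
  forall x, rho x = rang x.
Proof.
move=> rho_pure rhoD; elim/tensorW => s.
transitivity (W 1 0 s); last by rewrite -tensor_rang_pi.
rewrite pi_split.
move: (1 : A) (0 : B) => e b; elim: s e b => [|p s IHs] e b /=.
  by rewrite big_seq1 rho_pure W_nil.
rewrite big_cat /= rhoD ?IHs -?W_cons// !split_sum mulrACA -tensor_pureM.
by rewrite mulrACA mulb1B mulr0 tensor_pure0l mul0r.
Qed.

Definition tensor_inl_fun a : T := tensor_pure a 1.

Let inlD : zmod_morphism tensor_inl_fun.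
Proof.
move=> a a'; apply/eqP; rewrite eq_sym subr_eq -tensor_pureDl.
by rewrite addrNK.
Qed.

Let inlM : monoid_morphism tensor_inl_fun.
Proof.
by split=> // a a'; rewrite /tensor_inl_fun -tensor_pureM mulr1.
Qed.

HB.instance Definition _ := GRing.isZmodMorphism.Build A T tensor_inl_fun inlD.
HB.instance Definition _ :=
  GRing.isMonoidMorphism.Build A T tensor_inl_fun inlM.
HB.instance Definition _ := GRing.isScalable.Build 'F_2 A T *:%R
  tensor_inl_fun (additive_scalable tensor_inl_fun).

Let inl_rang a : rang (tensor_inl_fun a) = rang a :> R.
Proof. by rewrite [LHS]tensor_rang_pure rang1 mulr1. Qed.

Definition tensor_inl : hamming_embedding A T :=
  {| hamming_fun := tensor_inl_fun; hamming_funE := inl_rang |}.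

End TensorHamming.

(* The direct limit of T 0 -> T 1 -> T 2 -> ... is the disjoint union of the
   T k, in which two elements are identified when their images coincide
   in some T m.  Its rang function extends those of the T k, see dlim_in. *)
Section DirectLimit.
Variables (R : realType) (T : nat -> hammingType R).
Variable f : forall k, hamming_embedding (T k) (T k.+1).

Definition dunion : Type := {k : nat & T k}.
HB.instance Definition _ := Choice.on dunion.
Implicit Types u v w : dunion.

Definition inT k (x : T k) : dunion := Tagged (fun k => T k) x.

(* The image of u in T m if tag u <= m, and 0 otherwise. *)
Fixpoint image_in u m : T m :=
  if m is m'.+1 return T m then tagged_as (inT (f m' (image_in u m'))) u
  else tagged_as (inT (0 : T 0)) u.

Definition dlim_eq u v : Prop := exists m,
  [/\ (tag u <= m)%N, (tag v <= m)%N & image_in u m = image_in v m].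

Lemma image_in_tag u : image_in u (tag u) = tagged u.
Proof.
by case: u => -[|k] x; rewrite [LHS](@tagged_asE _ (fun k => T k) (inT _)).
Qed.

Lemma image_inT k (x : T k) : image_in (inT x) k = x.
Proof. exact: (image_in_tag (inT x)). Qed.

Lemma image_inS u m :
  (tag u <= m)%N -> image_in u m.+1 = f m (image_in u m).
Proof.
move=> um /=; rewrite /tagged_as; case: eqP => // /= mu.
by rewrite -mu ltnn in um.
Qed.

Let image_in_eqW u v m n : (tag u <= m)%N -> (tag v <= m)%N -> (m <= n)%N ->
  image_in u m = image_in v m -> image_in u n = image_in v n.
Proof.
move=> um vm /subnK <- uv; elim: (n - m)%N => // d IHd.
by rewrite addSn !image_inS ?IHd// (leq_trans _ (leq_addl _ _)).
Qed.

Lemma dlim_eqP u v : dlim_eq u v <->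
  exists N, forall m, (N <= m)%N -> image_in u m = image_in v m.
Proof.
split=> [[N [uN vN uv]]|[N uv]].
  by exists N => m Nm; exact: image_in_eqW uv.
exists (N + (tag u + tag v))%N; split.
- by rewrite addnCA leq_addr.
- by rewrite addnA leq_addl.
- by apply: uv; exact: leq_addr.
Qed.

Definition dlim_rel : rel dunion := fun u v => `[< dlim_eq u v >].

Let dlim_rel_refl : reflexive dlim_rel.
Proof. by move=> u; apply/asboolP/dlim_eqP; exists 0%N. Qed.

Let dlim_rel_sym : symmetric dlim_rel.
Proof.
by move=> u v; apply/asboolP/asboolP => -[m [*]]; exists m; split.
Qed.

Let dlim_rel_trans : transitive dlim_rel.
Proof.
move=> v u w /asboolP/dlim_eqP[M uv] /asboolP/dlim_eqP[N vw].
apply/asboolP/dlim_eqP; exists (M + N)%N => m MNm; rewrite uv ?vw//.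
  exact: leq_trans (leq_addl _ _) MNm.
exact: leq_trans (leq_addr _ _) MNm.
Qed.

Canonical dlim_equiv :=
  EquivRel dlim_rel dlim_rel_refl dlim_rel_sym dlim_rel_trans.

Definition direct_limit : Type := {eq_quot dlim_rel}.
Local Notation L := direct_limit.

HB.instance Definition _ := Choice.on L.
HB.instance Definition _ := EqQuotient.on L.

Lemma dlim_piE u v : \pi_L u = \pi_L v <-> dlim_eq u v.
Proof. by split=> [/eqmodP/asboolP|uv]; last exact/eqmodP/asboolP. Qed.

Lemma dlimW (P : L -> Prop) : (forall u, P (\pi_L u)) -> forall x, P x.
Proof. by move=> Ppi x; rewrite -[x]reprK. Qed.

Let repr_pi u : exists N, forall m, (N <= m)%N ->
  image_in (repr (\pi_L u)) m = image_in u m.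
Proof. by apply/dlim_eqP/dlim_piE; rewrite reprK. Qed.

Let opp_dunion u : dunion := inT (- tagged u).
Let add_dunion u v : dunion := let m := maxn (tag u) (tag v) in
  inT (image_in u m + image_in v m).
Let mul_dunion u v : dunion := let m := maxn (tag u) (tag v) in
  inT (image_in u m * image_in v m).

Definition dlim_zero : L := \pi_L (inT (0 : T 0)).
Definition dlim_one : L := \pi_L (inT (1 : T 0)).
Definition dlim_opp (x : L) : L := \pi_L (opp_dunion (repr x)).
Definition dlim_add (x y : L) : L := \pi_L (add_dunion (repr x) (repr y)).
Definition dlim_mul (x y : L) : L := \pi_L (mul_dunion (repr x) (repr y)).

Let image_zero m : image_in (inT (0 : T 0)) m = 0.
Proof.
by elim: m => [|m IHm]; rewrite ?image_inT// image_inS// IHm rmorph0.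
Qed.

Let image_one m : image_in (inT (1 : T 0)) m = 1.
Proof.
by elim: m => [|m IHm]; rewrite ?image_inT// image_inS// IHm rmorph1.
Qed.

Let image_opp u m : (tag u <= m)%N ->
  image_in (opp_dunion u) m = - image_in u m.
Proof.
move=> /subnK <-; elim: (m - _)%N => [|d IHd].
  by rewrite add0n image_inT image_in_tag.
by rewrite addSn !image_inS ?leq_addl// IHd rmorphN.
Qed.

Let image_add u v m : (tag u <= m)%N -> (tag v <= m)%N ->
  image_in (add_dunion u v) m = image_in u m + image_in v m.
Proof.
move=> um vm; have /subnK <- : (maxn (tag u) (tag v) <= m)%N.
  by rewrite geq_max um.
elim: (m - _)%N => [|d IHd]; first by rewrite add0n image_inT.
have le : (maxn (tag u) (tag v) <= d + maxn (tag u) (tag v))%N.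
  exact: leq_addl.
have := le; rewrite geq_max => /andP[led1 led2].
by rewrite addSn !image_inS// IHd rmorphD.
Qed.

Let image_mul u v m : (tag u <= m)%N -> (tag v <= m)%N ->
  image_in (mul_dunion u v) m = image_in u m * image_in v m.
Proof.
move=> um vm; have /subnK <- : (maxn (tag u) (tag v) <= m)%N.
  by rewrite geq_max um.
elim: (m - _)%N => [|d IHd]; first by rewrite add0n image_inT.
have le : (maxn (tag u) (tag v) <= d + maxn (tag u) (tag v))%N.
  exact: leq_addl.
have := le; rewrite geq_max => /andP[led1 led2].
by rewrite addSn !image_inS// IHd rmorphM.
Qed.

Let addE u v : dlim_add (\pi_L u) (\pi_L v) = \pi_L (add_dunion u v).
Proof.
apply/dlim_piE/dlim_eqP; have [M uM] := repr_pi u; have [N vN] := repr_pi v.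
set u' := repr _ in uM *; set v' := repr _ in vN *.
exists (maxn (maxn M N) (maxn (maxn (tag u) (tag v)) (maxn (tag u') (tag v')))).
move=> m; rewrite !geq_max => /andP[/andP[Mm Nm]].
move=> /andP[/andP[um vm] /andP[u'm v'm]].
by rewrite !image_add// uM ?vN.
Qed.

Let mulE u v : dlim_mul (\pi_L u) (\pi_L v) = \pi_L (mul_dunion u v).
Proof.
apply/dlim_piE/dlim_eqP; have [M uM] := repr_pi u; have [N vN] := repr_pi v.
set u' := repr _ in uM *; set v' := repr _ in vN *.
exists (maxn (maxn M N) (maxn (maxn (tag u) (tag v)) (maxn (tag u') (tag v')))).
move=> m; rewrite !geq_max => /andP[/andP[Mm Nm]].
move=> /andP[/andP[um vm] /andP[u'm v'm]].
by rewrite !image_mul// uM ?vN.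
Qed.

Let oppE u : dlim_opp (\pi_L u) = \pi_L (opp_dunion u).
Proof.
apply/dlim_piE/dlim_eqP; have [M uM] := repr_pi u.
set u' := repr _ in uM *; exists (maxn M (maxn (tag u) (tag u'))) => m.
by rewrite !geq_max => /and3P[Mm um u'm]; rewrite !image_opp// uM.
Qed.

Let pi_eq u v N : (forall m, (tag u <= m)%N -> (tag v <= m)%N -> (N <= m)%N ->
  image_in u m = image_in v m) -> \pi_L u = \pi_L v.
Proof.
move=> uv; apply/dlim_piE/dlim_eqP; exists (maxn (maxn (tag u) (tag v)) N) => m.
by rewrite !geq_max => /andP[/andP[um vm] Nm]; exact: uv.
Qed.

Let dlim_addA : associative dlim_add.
Proof.
move=> x y z; elim/dlimW: x => u; elim/dlimW: y => v; elim/dlimW: z => w.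
rewrite !addE; apply: (@pi_eq _ _ 0%N) => m /=.
rewrite !geq_max => /and3P[um vm wm] _ _.
by rewrite !image_add ?addrA//= geq_max ?um ?vm.
Qed.

Let dlim_addC : commutative dlim_add.
Proof.
move=> x y; elim/dlimW: x => u; elim/dlimW: y => v.
rewrite !addE; apply: (@pi_eq _ _ 0%N) => m /=.
rewrite !geq_max => /andP[um vm] _ _.
by rewrite !image_add// addrC.
Qed.

Let dlim_add0 : left_id dlim_zero dlim_add.
Proof.
move=> x; elim/dlimW: x => u; rewrite addE; apply: (@pi_eq _ _ 0%N) => m _ um _.
by rewrite image_add// image_zero add0r.
Qed.

Let dlim_addN : left_inverse dlim_zero dlim_opp dlim_add.
Proof.
move=> x; elim/dlimW: x => u; rewrite oppE addE.
apply: (@pi_eq _ _ (tag u)) => m _ _ um.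
by rewrite image_add// image_opp// image_zero addNr.
Qed.

HB.instance Definition _ :=
  GRing.isZmodule.Build L dlim_addA dlim_addC dlim_add0 dlim_addN.

Let dlim_mulA : associative dlim_mul.
Proof.
move=> x y z; elim/dlimW: x => u; elim/dlimW: y => v; elim/dlimW: z => w.
rewrite !mulE; apply: (@pi_eq _ _ 0%N) => m /=.
rewrite !geq_max => /and3P[um vm wm] _ _.
by rewrite !image_mul ?mulrA//= geq_max ?um ?vm.
Qed.

Let dlim_mulC : commutative dlim_mul.
Proof.
move=> x y; elim/dlimW: x => u; elim/dlimW: y => v.
rewrite !mulE; apply: (@pi_eq _ _ 0%N) => m /=.
rewrite !geq_max => /andP[um vm] _ _.
by rewrite !image_mul// mulrC.
Qed.

Let dlim_mul1 : left_id dlim_one dlim_mul.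
Proof.
move=> x; elim/dlimW: x => u; rewrite mulE; apply: (@pi_eq _ _ 0%N) => m _ um _.
by rewrite image_mul// image_one mul1r.
Qed.

Let dlim_mulDl : left_distributive dlim_mul dlim_add.
Proof.
move=> x y z; elim/dlimW: x => u; elim/dlimW: y => v; elim/dlimW: z => w.
rewrite addE !mulE addE; apply: (@pi_eq _ _ 0%N) => m /=.
rewrite !geq_max => /andP[/andP[um vm] wm] _ _.
by rewrite image_mul//= ?image_add ?image_mul ?mulrDl//= geq_max ?um ?vm ?wm.
Qed.

HB.instance Definition _ := GRing.Zmodule_isComPzRing.Build L
  dlim_mulA dlim_mulC dlim_mul1 dlim_mulDl.

Definition dlim_rang (x : L) : R := rang (tagged (repr x)).

Let rang_image u m : (tag u <= m)%N ->
  rang (image_in u m) = rang (tagged u) :> R.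
Proof.
move=> /subnK <-; elim: (m - _)%N => [|d IHd].
  by rewrite add0n image_in_tag.
by rewrite addSn image_inS ?leq_addl// hamming_funE.
Qed.

Let dlim_rang_pi u : dlim_rang (\pi_L u) = rang (tagged u).
Proof.
have [N uN] := repr_pi u; rewrite /dlim_rang; move: (repr _) uN => v uv.
have Nle : (N <= maxn N (maxn (tag u) (tag v)))%N by exact: leq_maxl.
have := leqnn (maxn N (maxn (tag u) (tag v))).
rewrite {1}geq_max => /andP[/uv uvE]; rewrite geq_max => /andP[um vm].
by rewrite -(rang_image um) -uvE rang_image.
Qed.

Let dlim_rang1 : dlim_rang 1 = 1.
Proof. by rewrite [LHS]dlim_rang_pi rang1. Qed.

Let dlim_one_neq0 : (1 : L) != 0.
Proof.
apply/eqP => /(congr1 dlim_rang); rewrite dlim_rang1 [RHS]dlim_rang_pi rang0.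
by move/eqP; rewrite oner_eq0.
Qed.

Let dlim_mulbb (x : L) : x * x = x.
Proof.
elim/dlimW: x => u; rewrite [LHS]mulE; apply: (@pi_eq _ _ 0%N) => m _ um _.
by rewrite image_mul// mulbb.
Qed.

HB.instance Definition _ :=
  ComPzRing_isBoolean.Build L dlim_one_neq0 dlim_mulbb.

Let dlim_rang_ge0 (x : L) : 0 <= dlim_rang x. Proof. exact: rang_ge0. Qed.

Let pi0P u : tagged u = 0 <-> \pi_L u = 0.
Proof.
split=> [u0|u0]; last first.
  apply/(rang_eq0 (s := T (tag u))); rewrite -dlim_rang_pi u0.
  by rewrite [LHS]dlim_rang_pi rang0.
apply: (@pi_eq _ _ 0%N) => m um _ _; rewrite image_zero.
by apply/(rang_eq0 (s := T m)); rewrite rang_image// u0 rang0.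
Qed.

Let dlim_rang_eq0 (x : L) : dlim_rang x = 0 -> x = 0.
Proof.
by elim/dlimW: x => u; rewrite dlim_rang_pi => /rang_eq0; exact: (pi0P u).1.
Qed.

Let dlim_rangD (x y : L) :
  x * y = 0 -> dlim_rang (x + y) = dlim_rang x + dlim_rang y.
Proof.
elim/dlimW: x => u; elim/dlimW: y => v.
rewrite [_ * _]mulE [_ + _]addE => /pi0P /= uv0; rewrite !dlim_rang_pi /=.
by rewrite rangD// !rang_image// ?leq_maxl ?leq_maxr.
Qed.

HB.instance Definition _ := BooleanAlgebra_hasRang.Build R L
  dlim_rang_ge0 dlim_rang_eq0 dlim_rang1 dlim_rangD.

Section Injection.
Variable k : nat.

Definition dlim_in_fun (x : T k) : L := \pi_L (inT x).

Let dlim_inB : zmod_morphism dlim_in_fun.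
Proof.
move=> x y; have -> : - dlim_in_fun y = \pi_L (opp_dunion (inT y)).
  exact: oppE.
rewrite [RHS]addE.
apply: (@pi_eq _ _ 0%N) => m km _ _; rewrite image_add ?image_opp//.
move/subnK: km => <-; elim: (m - _)%N => [|d IHd]; first by rewrite !image_inT.
by rewrite addSn !image_inS ?leq_addl// IHd rmorphB.
Qed.

Let dlim_inM : monoid_morphism dlim_in_fun.
Proof.
split=> [|x y].
  apply: (@pi_eq _ _ 0%N) => m km _ _; rewrite image_one.
  move/subnK: km => <-; elim: (m - _)%N => [|d IHd]; first by rewrite image_inT.
  by rewrite addSn !image_inS ?leq_addl// IHd rmorph1.
rewrite [RHS]mulE; apply: (@pi_eq _ _ 0%N) => m km _ _; rewrite image_mul//.
move/subnK: km => <-; elim: (m - _)%N => [|d IHd]; first by rewrite !image_inT.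
by rewrite addSn !image_inS ?leq_addl// IHd rmorphM.
Qed.

HB.instance Definition _ :=
  GRing.isZmodMorphism.Build (T k) L dlim_in_fun dlim_inB.
HB.instance Definition _ :=
  GRing.isMonoidMorphism.Build (T k) L dlim_in_fun dlim_inM.
HB.instance Definition _ := GRing.isScalable.Build 'F_2 (T k) L *:%R
  dlim_in_fun (additive_scalable dlim_in_fun).

Let dlim_in_rang x : rang (dlim_in_fun x) = rang x :> R.
Proof. exact: dlim_rang_pi. Qed.

Definition dlim_in : hamming_embedding (T k) L :=
  {| hamming_fun := dlim_in_fun; hamming_funE := dlim_in_rang |}.

End Injection.

Lemma dlim_inS k (x : T k) : dlim_in k.+1 (f k x) = dlim_in k x.
Proof.
apply: (@pi_eq _ _ 0%N) => m km _ _; move/subnK: km => <- /=.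
elim: (m - _)%N => [|d IHd].
  by rewrite add0n [LHS]image_inT image_inS// image_inT.
by rewrite addSn !image_inS ?leq_addl// ?IHd// addnS leqW// leq_addl.
Qed.

Lemma dlim_in_surj (x : L) : exists k (y : T k), x = dlim_in k y.
Proof. by elim/dlimW: x => -[k y]; exists k, y. Qed.

End DirectLimit.

Section InfiniteTensor.
Variables (R : realType) (A : nat -> hammingType R).

(* finite_tensor k is A 0 \otimes ... \otimes A k. *)
Fixpoint finite_tensor (k : nat) : hammingType R :=
  if k is k'.+1 then tensor (finite_tensor k') (A k) else A 0%N.

Definition infinite_tensor : hammingType R :=
  direct_limit (fun k => tensor_inl (finite_tensor k) (A k.+1)).

End InfiniteTensor.

(* Main.v *)
(* A subspace isomorphic to H_n is given by its atoms, n orthogonal elements of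
   rang 1/n and sum 1.  By local standardness, the atoms and any x in H lie in a
   subspace H' isomorphic to some H_m; as an atom of rang 1/n is the sum of q
   atoms of H', of rang 1/m each, m = n * q and the atoms of H' split each given
   atom into q equal parts.  Grouping these parts allows one to refine by one
   prime factor of q at a time.  Since H is countably infinite, this yields an
   infinite chain of subspaces H_1 < H_(p_1) < H_(p_1 p_2) < ... with union H.
   When each atom a_i is split into parts c_(i,0), ..., c_(i,q-1), the elements
   b_j = \sum_i c_(i,j) are the atoms of a subspace H_q which is independent of
   the old subspace H_n, and together they generate H_n \otimes H_q = H_(nq). *)

From HB Require Import structures.
Require Import Defs.
From mathcomp Require Import all_boot all_order all_algebra.
From mathcomp Require Import boolp classical_sets functions cardinality reals.

Set Implicit Arguments.
Unset Strict Implicit.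
Unset Printing Implicit Defensive.

Import Order.TTheory GRing.Theory Num.Theory.
Local Open Scope ring_scope.

(** * Hamming embeddings and isomorphisms with direct limits *)

Section Packaging.
Variables (R : realType) (A B : hammingType R) (f : A -> B).
Hypotheses (fB : zmod_morphism f) (fM : monoid_morphism f).
Hypothesis f_rang : forall x, rang (f x) = rang x :> R.

Let F : A -> B := f.
HB.instance Definition _ := GRing.isZmodMorphism.Build A B F fB.
HB.instance Definition _ := GRing.isMonoidMorphism.Build A B F fM.
HB.instance Definition _ :=
  GRing.isScalable.Build 'F_2 A B *:%R F (additive_scalable F).

Definition hamming_embedding_of : hamming_embedding A B :=
  {| hamming_fun := F; hamming_funE := f_rang |}.
End Packaging.

Section Cocone.
Variables (R : realType) (T : nat -> hammingType R) (B : hammingType R).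
Variable f : forall k, hamming_embedding (T k) (T k.+1).
Variable g : forall k, hamming_embedding (T k) B.
Hypothesis g_compat : forall k x, g k.+1 (f k x) = g k x.
Hypothesis g_surj : forall b, exists k x, b = g k x.
Local Notation L := (direct_limit f).

Let lift k m (x : T k) : (k <= m)%N ->
  exists y : T m, dlim_in f m y = dlim_in f k x /\ g m y = g k x.
Proof.
move=> /subnK <-; elim: (m - k)%N => [|d [y [yL yB]]]; first by exists x.
by rewrite addSn; exists (f _ y); rewrite dlim_inS g_compat.
Qed.

(* The isomorphism is glued from the inverses of the g k. *)
Let graph (b : B) (z : L) :=
  exists k (x : T k), b = g k x /\ z = dlim_in f k x.

Let graph2 b z b' z' : graph b z -> graph b' z' -> exists k (x x' : T k),
  [/\ b = g k x, z = dlim_in f k x, b' = g k x' & z' = dlim_in f k x'].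
Proof.
move=> [k [x [-> ->]]] [k' [x' [-> ->]]].
have [y [<- <-]] := lift x (leq_maxl k k').
have [y' [<- <-]] := lift x' (leq_maxr k k').
by exists (maxn k k'), y, y'.
Qed.

(** At a common stage both preimages have the same image under [g k], which is injective because it
    preserves rang. *)
Let graph_fun b z z' : graph b z -> graph b z' -> z = z'.
Proof.
move=> bz bz'; have [k [x [x' [-> -> + ->]]]] := graph2 bz bz'.
by move=> /hamming_embedding_inj ->.
Qed.

Lemma hamming_iso_direct_limit : hamming_iso B L.
Proof.
have /choice[psi psiP] : forall b, exists z, graph b z.
  by move=> b; have [k [x ->]] := g_surj b; exists (dlim_in f k x), k, x.
have psiE k x : psi (g k x) = dlim_in f k x.
  by apply: graph_fun (psiP _) _; exists k, x.
have psiB : zmod_morphism psi.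
  move=> b b'; have [k [x [x' [-> _ -> _]]]] := graph2 (psiP b) (psiP b').
  by rewrite -rmorphB !psiE rmorphB.
have psiM : monoid_morphism psi.
  split=> [|b b']; first by rewrite -(rmorph1 (g 0)) psiE rmorph1.
  have [k [x [x' [-> _ -> _]]]] := graph2 (psiP b) (psiP b').
  by rewrite -rmorphM !psiE rmorphM.
have psi_rang b : rang (psi b) = rang b :> R.
  by have [k [x ->]] := g_surj b; rewrite psiE !hamming_funE.
exists (hamming_embedding_of psiB psiM psi_rang).
have /choice[phi phiP] : forall z : L, exists b, psi b = z.
  by move=> z; have [k [x ->]] := dlim_in_surj z; exists (g k x).
exists phi => [b|z]; last exact: phiP.
apply: (@hamming_embedding_inj _ _ _ (hamming_embedding_of psiB psiM psi_rang)).
exact: phiP.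
Qed.

End Cocone.

(** * Equipartitions, refinements and residues *)

Lemma sum_ord_mul (V : nmodType) p r (F : nat -> V) :
  \sum_(k < p * r) F k = \sum_(j < p) \sum_(l < r) F (j * r + l)%N.
Proof.
rewrite -(big_mkord xpredT) big_nat_mul big_mkord; apply: eq_bigr => j _.
by rewrite -{1}[(j * r)%N]add0n big_addn mulSn addnK big_mkord;
  apply: eq_bigr => l _; rewrite addnC.
Qed.

Lemma rang_sum (R : realType) (H : hammingType R) (I : eqType) (r : seq I)
    (F : I -> H) :
  uniq r -> {in r &, forall i j, i != j -> F i * F j = 0} ->
  rang (\sum_(i <- r) F i) = \sum_(i <- r) rang (F i) :> R.
Proof.
elim: r => [|i r IHr] /=; first by rewrite !big_nil rang0.
case/andP=> ir r_uniq F_orth; rewrite !big_cons rangD ?IHr//.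
  by move=> j k jr kr; apply: F_orth; rewrite inE ?jr ?kr orbT.
rewrite mulr_sumr big_seq big1// => j jr; apply: F_orth; rewrite ?inE ?eqxx//.
  by rewrite jr orbT.
by apply: contraNneq ir => ->.
Qed.

Section Equipartition.
Variables (R : realType) (H : hammingType R).
Implicit Types (n m p q r : nat) (a c : nat -> H) (h x y : H).

(* The values a i for i >= n are irrelevant. *)
Definition equipartition n a : Prop :=
  [/\ (0 < n)%N,
      forall i j, (i < n)%N -> (j < n)%N -> i != j -> a i * a j = 0,
      \sum_(i < n) a i = 1
    & forall i, (i < n)%N -> rang (a i) = n%:R^-1 :> R].

(* The part j of the cell a i is c (i * q + j). *)
Definition refines n a q c : Prop :=
  forall i, (i < n)%N -> a i = \sum_(j < q) c (i * q + j)%N.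

(* h is a sum of cells a i, i.e., h lies in the subspace with atoms a i. *)
Definition resolves n a h : Prop :=
  forall i, (i < n)%N -> h * a i = 0 \/ h * a i = a i.

Lemma ltn_mulD n q i j : (i < n -> j < q -> i * q + j < n * q)%N.
Proof.
move=> ni qj; apply: (@leq_trans (i.+1 * q)); last by rewrite leq_mul2r ni orbT.
by rewrite mulSn addnC ltn_add2r.
Qed.

Lemma eqn_mulD q i j i' j' : (j < q -> j' < q ->
  (i * q + j == i' * q + j') = (i == i') && (j == j'))%N.
Proof.
move=> jq j'q; have q0 : (0 < q)%N by case: q jq j'q.
apply/eqP/andP => [ij|[/eqP-> /eqP->]//].
have := congr1 (divn^~ q) ij; have := congr1 (modn^~ q) ij.
by rewrite !modnMDl !modn_small// !divnMDl// !divn_small// !addn0 => -> ->.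
Qed.

Lemma equipartition_sum_rang n a h : equipartition n a ->
  rang h = \sum_(i < n) rang (h * a i) :> R.
Proof.
case=> _ a_orth a_sum _; rewrite -{1}(mulr1 h) -a_sum mulr_sumr rang_sum//.
  exact: index_enum_uniq.
by move=> i j _ _ ij; rewrite mulrACA a_orth ?mulr0.
Qed.

Section Refinement.
Variables (n q : nat) (a c : nat -> H).
Hypotheses (aP : equipartition n a) (cP : equipartition (n * q) c).
Hypothesis ac : refines n a q c.

Lemma refines_mul i i' j : (i < n)%N -> (i' < n)%N -> (j < q)%N ->
  a i * c (i' * q + j)%N = if i == i' then c (i' * q + j)%N else 0.
Proof.
move=> ni ni' qj; case: cP => _ c_orth _ _; rewrite ac// mulr_suml.
case: eqVneq => [<-|ii'].
  rewrite (bigD1 (Ordinal qj))//= mulbb big1 ?addr0// => j' jj'.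
  rewrite c_orth ?ltn_mulD// eqn_mulD// eqxx /=.
  by apply: contraNneq jj' => jj'; exact/eqP/val_inj.
rewrite big1// => j' _; rewrite c_orth ?ltn_mulD// eqn_mulD//.
by rewrite (negPf ii').
Qed.

Lemma ltn_mulP k : (k < n * q)%N ->
  exists i j, [/\ (i < n)%N, (j < q)%N & k = i * q + j]%N.
Proof.
move=> knq; have q0 : (0 < q)%N by case: q knq; rewrite ?muln0.
exists (k %/ q)%N, (k %% q)%N.
by rewrite ltn_divLR// ltn_mod q0 -divn_eq.
Qed.

Lemma resolves_refines h : resolves n a h -> resolves (n * q) c h.
Proof.
move=> ah _ /ltn_mulP[i [j [ni qj ->]]].
have /esym ai := refines_mul ni ni qj; rewrite eqxx in ai.
rewrite ai mulrA; case: (ah i ni) => ->; last by right.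
by rewrite mul0r; left.
Qed.

(** This is the element [b_j] of the overview; the name refers to indices modulo [q]. *)
Definition residue j : H := \sum_(i < n) c (i * q + j)%N.

Lemma residue_mul i j : (i < n)%N -> (j < q)%N ->
  a i * residue j = c (i * q + j)%N.
Proof.
move=> ni qj; rewrite mulr_sumr (bigD1 (Ordinal ni))//= refines_mul// eqxx.
rewrite big1 ?addr0// => i' ii'; rewrite refines_mul//.
by rewrite ifN// eq_sym.
Qed.

Lemma residue_resolved j : (j < q)%N -> resolves (n * q) c (residue j).
Proof.
move=> qj _ /ltn_mulP[i [j' [ni qj' ->]]].
have := refines_mul ni ni qj'; rewrite eqxx => <-.
rewrite mulrA [residue j * _]mulrC residue_mul//.
case: cP => _ c_orth _ _; have := refines_mul ni ni qj'; rewrite eqxx => ->.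
case: (eqVneq j j') => [->|jj']; first by right; rewrite mulbb.
by left; rewrite c_orth ?ltn_mulD// eqn_mulD// eqxx.
Qed.

(** Since the cells sum to 1, it suffices to multiply by each [a i], taken twice by idempotence;
    this turns the two residues into distinct parts of one cell. *)
Lemma residue_orth j j' : (j < q)%N -> (j' < q)%N -> j != j' ->
  residue j * residue j' = 0.
Proof.
move=> qj qj' jj'; case: cP => _ c_orth _ _; case: aP => _ _ a_sum _.
rewrite -[LHS]mul1r -a_sum mulr_suml big1// => i _.
rewrite -[a i]mulbb mulrACA !residue_mul// c_orth ?ltn_mulD//.
by rewrite eqn_mulD// eqxx.
Qed.

Lemma residue_sum : \sum_(j < q) residue j = 1.
Proof. by rewrite exchange_big /= -sum_ord_mul; case: cP. Qed.

(** Independence of [b_j] from the old subspace: each cell below [h] has rang 1/n and meets the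
    residue in a single part, of rang 1/(nq), while the other cells contribute 0. *)
Lemma residue_rang h j : resolves n a h -> (j < q)%N ->
  rang (h * residue j) = rang h / q%:R :> R.
Proof.
move=> ah qj; rewrite !(equipartition_sum_rang _ aP) mulr_suml.
apply: eq_bigr => i _; rewrite mulrAC -mulrA residue_mul//.
have := refines_mul (ltn_ord i) (ltn_ord i) qj; rewrite eqxx => <-.
rewrite mulrA; case: (ah i (ltn_ord i)) => ->; first by rewrite mul0r !rang0 mul0r.
case: aP cP => _ _ _ a_rang [_ _ _ c_rang]; rewrite refines_mul// eqxx.
by rewrite a_rang// c_rang ?ltn_mulD// natrM invfM.
Qed.

End Refinement.

End Equipartition.

(** * Equipartitions supplied by local standardness *)

Lemma F2_cases (P : 'F_2 -> Prop) : P 0 -> P 1 -> forall c, P c.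
Proof.
move=> P0 P1 [[|[|//]] c].
  by rewrite (_ : Ordinal c = 0)//; exact/val_inj.
by rewrite (_ : Ordinal c = 1)//; exact/val_inj.
Qed.

(** The witnesses are the coordinate vectors: multiplying by one keeps a single coordinate, which is
    0 or 1 in ['F_2]. *)
Lemma std_hamming_equipartition (R : realType) m (m_gt0 : (0 < m)%N) :
  exists e : nat -> (std_hamming m_gt0 : hammingType R),
    equipartition m e /\ forall x, resolves m e x.
Proof.
pose e (l : nat) : std_hamming m_gt0 := [ffun i : 'I_m => (i == l :> nat)%:R].
have eE x l (lm : (l < m)%N) : x * e l = [ffun i => x (Ordinal lm) * e l i].
  apply/ffunP => i; rewrite !ffunE; case: eqP => [il|_]; last by rewrite !mulr0.
  by congr (x _ * _); exact/val_inj.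
exists e; split; [split=> //|] => [i j im jm ij||i im|x l lm].
- rewrite eE; apply/ffunP => k.
  by rewrite !ffunE /= [j == i]eq_sym (negPf ij) mul0r.
- apply/ffunP => i; rewrite sum_ffunE (bigD1 i)//= !ffunE eqxx big1 ?addr0//.
  move=> j ji; rewrite ffunE; case: eqP => // /val_inj ij.
  by rewrite ij eqxx in ji.
- rewrite [LHS]/(_ * _) (bigD1 (Ordinal im))//= ffunE eqxx big1 ?addr0.
    exact: mulr1.
  move=> j ji; rewrite ffunE; case: eqP => // ij.
  by case/eqP: ji; exact/val_inj.
- rewrite eE; elim/F2_cases: (x _); [left|right]; apply/ffunP => k.
    by rewrite !ffunE mul0r.
  by rewrite !ffunE mul1r.
Qed.

Section Extension.
Variables (R : realType) (H : hammingType R).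
Implicit Types (n m p q r : nat) (a c e : nat -> H) (h x y : H).

(** The atoms of a standard subspace containing [s] are carried back to [H] by the inverse of [f];
    algebraic identities are checked after applying the injective [f]. *)
Lemma locally_standard_equipartition (s : seq H) : locally_standard H ->
  exists m e, equipartition m e /\ {in s, forall x, resolves m e x}.
Proof.
move=> /(_ s)[S [sS [m [m_gt0 [f [g fK gK]]]]]].
have [d [[_ d_orth d_sum d_rang] d_res]] := std_hamming_equipartition R m_gt0.
have f_inj := can_inj fK; pose v : {rmorphism hamming_subspace S -> H} := val.
exists m, (fun l => v (g (d l))); split; first split => // [i j im jm ij||i im].
- rewrite -rmorphM -(rmorph0 v); congr (v _); apply: f_inj.
  by rewrite rmorphM /= !gK rmorph0 d_orth.
- rewrite -rmorph_sum -(rmorph1 v); congr (v _); apply: f_inj.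
  by rewrite rmorph_sum rmorph1 -d_sum /=; apply: eq_bigr => i _; rewrite gK.
- by rewrite -(d_rang i im) -[in RHS](gK (d i)) hamming_funE.
move=> x /sS xS l lm; pose u : hamming_subspace S := Sub x xS.
rewrite -[x]/(v u) -rmorphM -(rmorph0 v).
have [ud|ud] := d_res (f u) l lm; [left|right]; congr (v _); apply: f_inj.
  by rewrite rmorphM /= gK rmorph0.
by rewrite rmorphM /= gK.
Qed.

(** Each [a i] has rang 1/n and is a sum of atoms of rang 1/m, so all cells contain the same number
    m/n of atoms. Then [c] is [e] reindexed cell by cell. *)
Lemma resolved_refinement n a m e : equipartition n a -> equipartition m e ->
    (forall i, (i < n)%N -> resolves m e (a i)) ->
  exists q c, [/\ equipartition (n * q) c, refines n a q c
    & forall h, resolves m e h -> resolves (n * q) c h].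
Proof.
move=> [n0 a_orth a_sum a_rang] eP ae; have [m0 e_orth e_sum e_rang] := eP.
pose L i := [seq l <- iota 0 m | a i * e l == e l].
have LE i l : (l \in L i) = (a i * e l == e l) && (l < m)%N.
  by rewrite mem_filter mem_iota add0n.
have aeE i l : (i < n)%N -> (l < m)%N ->
    a i * e l = if a i * e l == e l then e l else 0.
  by move=> ni lm; case: eqP => // ne; case: (ae i ni l lm).
have aL i : (i < n)%N -> a i = \sum_(l <- L i) e l.
  move=> ni; rewrite big_filter -[LHS]mulr1 -e_sum mulr_sumr.
  have -> : iota 0 m = index_iota 0 m by rewrite /index_iota subn0.
  rewrite big_mkord [RHS]big_mkcond /=.
  by apply: eq_bigr => l _; exact: aeE.
have sizeL i : (i < n)%N -> (size (L i) * n)%N = m.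
  move=> ni; have := a_rang i ni; rewrite {1}aL// rang_sum.
  - rewrite (eq_big_seq (fun=> m%:R^-1)); last first.
      by move=> l; rewrite LE => /andP[_]; exact: e_rang.
    rewrite big_const_seq count_predT iter_addr_0.
    rewrite -[X in X = _]mulr_natl => /eqP.
    have nR : n%:R != 0 :> R by rewrite pnatr_eq0 -lt0n.
    have mR : m%:R != 0 :> R by rewrite pnatr_eq0 -lt0n.
    rewrite -[X in _ == X]div1r eqr_div// mul1r -natrM eqr_nat => /eqP->.
    by [].
  - by rewrite filter_uniq ?iota_uniq.
  by move=> l l'; rewrite !LE => /andP[_ lm] /andP[_ l'm]; exact: e_orth.
pose q := size (L 0); have mE : m = (n * q)%N by rewrite mulnC sizeL.
have {}sizeL i : (i < n)%N -> size (L i) = q.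
  by move=> ni; apply/eqP; rewrite -(eqn_pmul2r n0) !sizeL.
(* For [k = i * q + j] this picks the [j]-th atom below [a i], so that the parts of one cell become
   consecutive. *)
pose l k := nth 0%N (L (k %/ q)%N) (k %% q)%N.
have lE i j : (i < n)%N -> (j < q)%N -> l (i * q + j)%N = nth 0%N (L i) j.
  move=> ni qj; rewrite /l modnMDl modn_small// divnMDl ?divn_small ?addn0//.
  by case: (q) qj.
have lL i j : (i < n)%N -> (j < q)%N -> l (i * q + j)%N \in L i.
  by move=> ni qj; rewrite lE// mem_nth// sizeL.
have lm k : (k < n * q)%N -> (l k < m)%N.
  move=> /ltn_mulP[i [j [ni qj ->]]].
  by have := lL _ _ ni qj; rewrite LE => /andP[].
have ac : refines n a q (e \o l).
  move=> i ni; rewrite {1}aL// (big_nth 0%N) sizeL// big_mkord.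
  by apply: eq_bigr => j _; rewrite /= lE.
exists q, (e \o l); split=> //.
- split; first by rewrite -mE.
  + move=> k k' kq kq' /=; move: (lm k kq) (lm k' kq').
    move/ltn_mulP: kq => [i [j [ni qj ->]]].
    move/ltn_mulP: kq' => [i' [j' [ni' qj' ->]]].
    (* Within a cell the list [L i] has no repetition; across cells each atom absorbs its own [a i],
       and these are orthogonal. *)
    rewrite eqn_mulD//; case: (eqVneq i i') => [<- /=|ii' _ _ _].
      move=> lm1 lm2 jj'; rewrite e_orth// !lE// nth_uniq ?sizeL//.
      by rewrite filter_uniq ?iota_uniq.
    have /[!LE]/andP[/eqP <- _] := lL _ _ ni qj.
    have /[!LE]/andP[/eqP <- _] := lL _ _ ni' qj'.
    by rewrite mulrACA a_orth ?mul0r.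
  + by rewrite sum_ord_mul -a_sum; apply: eq_bigr => i _; rewrite ac.
  + by move=> k kq; rewrite /= e_rang ?lm// mE.
- by move=> h eh k kq; apply: eh; exact: lm.
Qed.

(** The least such [q] measures how far [h] is from being resolved; its decrease makes the chain
    exhaust [H]. *)
Definition reachable n a q h : Prop :=
  exists c, [/\ equipartition (n * q) c, refines n a q c
    & resolves (n * q) c h].

Hypothesis H_std : locally_standard H.

(** Local standardness is applied to [h] together with all the cells, so that the cells too are sums
    of atoms. *)
Lemma refinement_resolving n a h : equipartition n a ->
  exists q, reachable n a q h.
Proof.
move=> aP; have [m [e [eP se]]] :=
  locally_standard_equipartition (h :: map a (iota 0 n)) H_std.
have ae i : (i < n)%N -> resolves m e (a i).
  by move=> ni; apply: se; rewrite inE map_f ?orbT// mem_iota.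
have [q [c [cP ac cr]]] := resolved_refinement aP eP ae.
by exists q, c; split=> //; apply/cr/se; rewrite inE eqxx.
Qed.

(** Summing blocks of [r] consecutive parts gives the intermediate level. *)
Lemma refinement_split n a p r c : equipartition n a ->
    equipartition (n * (p * r)) c -> refines n a (p * r) c ->
  exists a', [/\ equipartition (n * p) a', refines n a p a'
    & refines (n * p) a' r c].
Proof.
move=> [n0 a_orth a_sum a_rang] [c0 c_orth c_sum c_rang] ac.
have r0 : (0 < r)%N.
  by case: r c0 {c_orth c_sum c_rang ac} => //; rewrite !muln0.
pose a' k := \sum_(l < r) c (k * r + l)%N.
have ltc k l : (k < n * p)%N -> (l < r)%N -> (k * r + l < n * (p * r))%N.
  by move=> kn lr; rewrite mulnA ltn_mulD.
exists a'; split=> //.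
- split=> [|k k' kn kn' kk'||k kn].
  + by move: c0; rewrite mulnA muln_gt0 => /andP[].
  + rewrite mulr_suml big1// => l _; rewrite mulr_sumr big1// => l' _.
    by rewrite c_orth ?ltc// eqn_mulD// (negPf kk').
  + by rewrite -c_sum mulnA [RHS]sum_ord_mul.
  + rewrite rang_sum ?index_enum_uniq//.
      rewrite (eq_bigr (fun=> (n * (p * r))%:R^-1)) => [|l _]; last first.
        by rewrite c_rang ?ltc.
      rewrite sumr_const card_ord -[LHS]mulr_natr mulnA natrM invfM.
      rewrite -mulrA mulVf ?mulr1//.
      by rewrite pnatr_eq0 -lt0n.
    move=> l l' _ _ ll'; rewrite c_orth ?ltc// eqn_mulD// eqxx /=.
    exact: ll'.
- move=> i ni; rewrite ac// (sum_ord_mul _ _ (fun k => c (i * (p * r) + k)%N)).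
  apply: eq_bigr => j _.
  by apply: eq_bigr => l _; rewrite mulnA addnA mulnDl.
Qed.

End Extension.

(** * A chain of prime refinements exhausting [H] *)

Section PrimeRefinements.
Variables (R : realType) (H : hammingType R).
Implicit Types (n p q N : nat) (a c : nat -> H) (x : H).

(** A resolved element is determined by the set of cells below it, so at most [2 ^ n] elements are
    resolved, while [u] takes infinitely many values. *)
Lemma equipartition_unresolved n a (u : nat -> H) : injective u ->
  equipartition n a -> exists i, ~ resolves n a (u i).
Proof.
move=> u_inj [_ _ a_sum _]; apply: contrapT => /forallNP u_res.
pose T := {set 'I_n}; pose phi (x : H) : T := [set i : 'I_n | x * a i == a i].
suff phi_inj : injective (fun i : 'I_#|T|.+1 => phi (u i)).
  by have := leq_card _ phi_inj; rewrite card_ord ltnn.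
move=> i j /setP phi_ij; apply/val_inj/u_inj.
rewrite -[LHS]mulr1 -[RHS]mulr1 -a_sum !mulr_sumr; apply: eq_bigr => k _.
have := phi_ij k; rewrite !inE.
have [|] := contrapT (u_res i) k (ltn_ord k) => ->;
  have [|] := contrapT (u_res j) k (ltn_ord k) => -> //;
  rewrite eqxx; first [by move=> /eqP | by move=> /esym/eqP].
Qed.

Lemma reachable1 n a x : reachable n a 1 x -> resolves n a x.
Proof.
move=> [c [_ ac cx]] i ni; rewrite ac// big_ord1 muln1 addn0.
by apply: cx; rewrite muln1.
Qed.

Hypothesis H_std : locally_standard H.
Variable h : nat -> H.
Hypothesis h_bij : bijective h.

(* h N being the first unresolved element, the refinement is chosen so that the
   least q for which h N is reachable decreases. *)
Lemma prime_refinement n a : equipartition n a ->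
  exists pc : nat * (nat -> H), let: (p, c) := pc in
  [/\ prime p, equipartition (n * p) c, refines n a p c
    & forall N, (forall M, (M < N)%N -> resolves n a (h M)) ->
        ~ resolves n a (h N) ->
      forall q, reachable n a q (h N) ->
      exists2 q', (q' < q)%N & reachable (n * p) c q' (h N)].
Proof.
move=> aP; have exN : exists N, `[< ~ resolves n a (h N) >].
  have [N hN] := equipartition_unresolved (bij_inj h_bij) aP.
  by exists N; exact/asboolP.
have [N /asboolP aN N_min] := ex_minnP exN.
have exq : exists q, `[< reachable n a q (h N) >].
  have [q qN] := refinement_resolving H_std (h N) aP.
  by exists q; exact/asboolP.
have [q /asboolP qN q_min] := ex_minnP exq.
have [c [cP ac cN]] := qN.
(* [q = 0] would leave an empty partition, and [q = 1] would mean that [h N] is already resolved. *)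
have q_gt1 : (1 < q)%N.
  case: q qN cP {q_min ac cN} => [|[|//]] => [_ [+ _ _ _]|].
    by rewrite muln0.
  by move=> /reachable1.
(* The smallest prime divisor [p] of the least [q] is split off, which leaves [r = q / p] parts for
   later. *)
have p_prime := pdiv_prime q_gt1.
have /esym qE := divnK (pdiv_dvd q); rewrite mulnC in qE.
set p := pdiv q in p_prime qE *; set r := (q %/ p)%N in qE.
rewrite qE in cP ac cN.
have [c' [c'P ac' c'c]] := refinement_split aP cP ac.
exists (p, c'); split=> // N' ltN' aN'.
have -> : N' = N.
  apply/eqP; rewrite eqn_leq N_min ?andbT; last exact/asboolP.
  by rewrite leqNgt; apply/negP => /ltN'.
(* [c] itself splits each cell of [c'] into [r] parts, and [r < q <= q'] by minimality of [q]. *)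
move=> q' qN'; exists r.
  apply: (@leq_trans q); last by apply: q_min; exact/asboolP.
  by rewrite ltn_Pdiv ?prime_gt1// ltnW.
by exists c; rewrite -mulnA.
Qed.

Lemma prime_refinements :
  exists (p n : nat -> nat) (a : nat -> nat -> H),
  [/\ forall k, prime (p k),
      n 0%N = 1%N /\ (forall k, n k.+1 = (n k * p k)%N),
      forall k, equipartition (n k) (a k),
      forall k, refines (n k) (a k) (p k) (a k.+1)
    & forall x, exists k, resolves (n k) (a k) x].
Proof.
pose valid (s : nat * (nat -> H)) := equipartition s.1 s.2.
(* The step function is total; its value at a family that is not an equipartition is arbitrary. *)
have /choice[f fP] : forall s, exists pc : nat * (nat -> H), valid s ->
    let: (p, c) := pc in
    [/\ prime p, equipartition (s.1 * p) c, refines s.1 s.2 p c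
    & forall N, (forall M, (M < N)%N -> resolves s.1 s.2 (h M)) ->
        ~ resolves s.1 s.2 (h N) ->
      forall q, reachable s.1 s.2 q (h N) ->
      exists2 q', (q' < q)%N & reachable (s.1 * p) c q' (h N)].
  move=> s; have [/prime_refinement[pc pcP]|ns] := pselect (valid s).
    by exists pc.
  by exists (2%N, s.2).
(* The chain starts from the partition with the single cell 1. *)
pose s := fix s k := if k is k'.+1
  then ((s k').1 * (f (s k')).1, (f (s k')).2)%N else (1%N, fun=> 1).
have sP k : valid (s k).
  elim: k => [|k /fP /=]; last by case: (f (s k)) => p c [].
  split=> //= [[|i] [|j]||i _] //; first by rewrite big_ord1.
  by rewrite rang1 invr1.
exists (fun k => (f (s k)).1), (fun k => (s k).1), (fun k => (s k).2).
have {fP} := fun k => fP _ (sP k) => fsP.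
split=> // [k|k|x]; first by case: (f (s k)) (fsP k) => p c [].
  by move=> /=; case: (f (s k)) (fsP k) => p c [].
have resS k y : resolves (s k).1 (s k).2 y -> resolves (s k.+1).1 (s k.+1).2 y.
  move: (sP k) (sP k.+1) (fsP k); rewrite /valid /=.
  case: (f (s k)) => p c akP cP [_ _ ac _]; exact: resolves_refines.
have [h' _ h'K] := h_bij; rewrite -(h'K x); move: (h' x) => N {x}.
suff [k kN] : exists k, forall M, (M < N.+1)%N ->
    resolves (s k).1 (s k).2 (h M).
  by exists k; exact: kN.
elim: (N.+1) => [|{}N [k kN]]; first by exists 0%N.
have [q] := refinement_resolving H_std (h N) (sP k).
(* While [h N] is unresolved it is the first such element, so each stage lowers [q]; the descent can
   only end with [h N] resolved. Earlier elements stay resolved by [resS]. *)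
elim/ltn_ind: q k kN => q IHq k kN kq.
have [kNr|kNr] := pselect (resolves (s k).1 (s k).2 (h N)).
  by exists k => M; rewrite ltnS leq_eqVlt => /predU1P[->//|]; exact: kN.
have [q' q'q q'r] : exists2 q', (q' < q)%N &
    reachable (s k.+1).1 (s k.+1).2 q' (h N).
  by move: (fsP k) => /=; case: (f (s k)) => p c [_ _ _]; exact.
by apply: (IHq q') q'r => // M MN; exact/resS/kN.
Qed.

End PrimeRefinements.

(** * The subalgebra of sums of cells *)

Section ResolvedSubalgebra.
Variables (R : realType) (H : hammingType R) (n : nat) (a : nat -> H).
Implicit Types x y : H.

Lemma resolves0 : resolves n a 0.
Proof. by move=> i _; rewrite mul0r; left. Qed.

Lemma resolvesD x y : resolves n a x -> resolves n a y -> resolves n a (x + y).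
Proof.
move=> ax ay i ni; rewrite mulrDl.
have [|] := ax i ni => ->; have [|] := ay i ni => ->;
  by rewrite ?addr0 ?add0r ?Defs.addbb; auto.
Qed.

Lemma resolvesM x y : resolves n a x -> resolves n a y -> resolves n a (x * y).
Proof.
move=> ax ay i ni; rewrite -mulrA.
by have [|] := ay i ni => ->; [rewrite mulr0; left | exact: ax].
Qed.

Lemma resolves_cell : equipartition n a ->
  forall i, (i < n)%N -> resolves n a (a i).
Proof.
case=> _ a_orth _ _ i ni j nj; case: (eqVneq i j) => [->|ij].
  by right; rewrite mulbb.
by left; exact: a_orth.
Qed.

(** Since the cells sum to 1, [x] is the sum of the products [x * a i], each of which is 0 or a
    cell. *)
Lemma resolves_ind (P : H -> Prop) x : equipartition n a ->
  P 0 -> (forall y z, P y -> P z -> P (y + z)) ->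
  (forall i, (i < n)%N -> P (a i)) -> resolves n a x -> P x.
Proof.
case=> _ _ a_sum _ P0 PD Pa ax.
rewrite -[x]mulr1 -a_sum mulr_sumr; elim/big_ind: _ => // i _.
by case: (ax i (ltn_ord i)) => ->//; exact: Pa.
Qed.

End ResolvedSubalgebra.

(** * Adjoining a standard factor to an embedded subspace *)

Section TensorStep.
Variables (R : realType) (H : hammingType R) (n q : nat) (a c : nat -> H).
Hypotheses (aP : equipartition n a) (cP : equipartition (n * q) c).
Hypothesis ac : refines n a q c.
Hypothesis q_gt0 : (0 < q)%N.
Local Notation S := (std_hamming q_gt0 : hammingType R).
Local Notation b := (residue n q c).
Implicit Types (x : H) (y : S).

(** The embedding of the new factor [H_q], taking coordinate vectors to residues. *)
Definition residue_fun y : H := \sum_(j < q) y j *: b j.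

Lemma residue_funB : zmod_morphism residue_fun.
Proof.
move=> y y'; rewrite -sumrB; apply: eq_bigr => j _.
by rewrite !ffunE scalerBl.
Qed.

Lemma residue_funM : monoid_morphism residue_fun.
Proof.
split=> [|y y'].
  rewrite -(residue_sum cP); apply: eq_bigr => j _.
  by rewrite ffunE scale1r.
rewrite [RHS]mulr_suml; apply: eq_bigr => j _.
rewrite mulr_sumr (bigD1 j)//= big1 ?addr0.
  by rewrite -scalerAl -scalerAr scalerA mulbb ffunE.
move=> j' jj'; rewrite -scalerAl -scalerAr (residue_orth aP cP ac) ?scaler0//.
by rewrite eq_sym.
Qed.

Lemma residue_fun_delta j : (j < q)%N ->
  exists y, residue_fun y = b j.
Proof.
move=> qj; exists [ffun i : 'I_q => (i == j :> nat)%:R].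
rewrite /residue_fun (bigD1 (Ordinal qj))//= ffunE eqxx scale1r big1 ?addr0//.
by move=> i ij; rewrite ffunE [_ == _](negPf ij) scale0r.
Qed.

Lemma residue_fun_resolved y : resolves (n * q) c (residue_fun y).
Proof.
rewrite /residue_fun; elim/big_ind: _ => [||j _].
- exact: resolves0.
- exact: resolvesD.
- elim/F2_cases: (y j); first by rewrite scale0r; exact: resolves0.
  by rewrite scale1r; exact: (residue_resolved cP ac).
Qed.

(** Orthogonality of the residues reduces this to [residue_rang], one coordinate of [y] at a
    time. *)
Lemma residue_fun_rang x y : resolves n a x ->
  rang (x * residue_fun y) = rang x * rang y :> R.
Proof.
move=> ax; rewrite mulr_sumr rang_sum ?index_enum_uniq//; last first.
  move=> j j' _ _ jj'; rewrite mulrACA -scalerAl -!scalerAr.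
  by rewrite (residue_orth aP cP ac) ?mulr0 ?scaler0.
rewrite [rang y]/(_ * _) mulrA mulr_sumr; apply: eq_bigr => j _.
elim/F2_cases: (y j); first by rewrite scale0r mulr0 rang0 mulr0.
by rewrite scale1r mulr1 (residue_rang aP cP ac).
Qed.

Let residue_fun_rang1 y : rang (residue_fun y) = rang y :> R.
Proof.
rewrite -[residue_fun y]mul1r residue_fun_rang ?rang1 ?mul1r//.
by move=> i _; rewrite mul1r; right.
Qed.

Definition residue_embedding : hamming_embedding S H :=
  hamming_embedding_of residue_funB residue_funM residue_fun_rang1.

(** This starts the tower: when the only cell is 1, its parts are the residues themselves. *)
Lemma residue_embedding_surj x :
  n = 1%N -> resolves (n * q) c x -> exists y, x = residue_embedding y.
Proof.
move=> n1; apply: (resolves_ind (P := fun x => exists z, _ = _ z) cP)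
  => [|_ _ [z ->] [w ->]|k].
- by exists 0; rewrite rmorph0.
- by exists (z + w); rewrite rmorphD.
move=> /ltn_mulP[i [j [ni qj ->]]]; have [y yj] := residue_fun_delta qj.
exists y; rewrite [RHS]yj -(residue_mul cP ac ni qj); case: aP => _ _ + _.
by rewrite n1 big_ord1; case: i ni => [|i]; rewrite n1// => _ ->; rewrite mul1r.
Qed.

Section Tensor.
Variables (A : hammingType R) (g : hamming_embedding A H).
Hypothesis g_res : forall z, resolves n a (g z).
Local Notation T := (tensor A S).

Let gb (u : A) y : H := g u * residue_fun y.

Let residue_funD : {morph residue_fun : y y' / y + y'}.
Proof.
by move=> y y'; rewrite -[y' in LHS]oppb residue_funB oppb.
Qed.

Let gbDl u u' y : gb (u + u') y = gb u y + gb u' y.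
Proof. by rewrite /gb rmorphD mulrDl. Qed.

Let gbDr u y y' : gb u (y + y') = gb u y + gb u y'.
Proof. by rewrite /gb residue_funD mulrDr. Qed.

Definition tensor_fun : T -> H := tensor_lift gb.

Lemma tensor_fun_pure u y : tensor_fun (tensor_pure u y) = g u * residue_fun y.
Proof. exact: tensor_lift_pure. Qed.

Let tensor_funD : {morph tensor_fun : z w / z + w}.
Proof. exact: tensor_liftD. Qed.

Lemma tensor_funB : zmod_morphism tensor_fun.
Proof. by move=> z w; rewrite !oppb tensor_funD. Qed.

Let tensor_fun0 : tensor_fun 0 = 0.
Proof. by rewrite -(subrr (0 : T)) tensor_funB subrr. Qed.

Lemma tensor_funM : monoid_morphism tensor_fun.
Proof.
have [b1 bM] := residue_funM.
split=> [|z w]; first by rewrite -tensor_pure1 tensor_fun_pure b1 rmorph1 mulr1.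
have sumE := big_morph tensor_fun tensor_funD tensor_fun0.
rewrite (tensor_sumE z) (tensor_sumE w) mulr_suml !sumE mulr_suml.
apply: eq_bigr => u _; rewrite !mulr_sumr sumE; apply: eq_bigr => v _.
by rewrite -tensor_pureM !tensor_fun_pure rmorphM bM mulrACA.
Qed.

(** The pulled-back rang is multiplicative on pure tensors and additive on orthogonal sums, so it is
    the tensor rang by uniqueness. *)
Lemma tensor_fun_rang z : rang (tensor_fun z) = rang z :> R.
Proof.
apply: (@tensor_rang_uniq R A S (fun z => rang (tensor_fun z)))
  => [u y|w w' ww'].
  by rewrite tensor_fun_pure residue_fun_rang// hamming_funE.
rewrite tensor_funD rangD//; have [_ tM] := tensor_funM.
by rewrite -tM ww' tensor_fun0.
Qed.

Definition tensor_embedding : hamming_embedding T H :=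
  hamming_embedding_of tensor_funB tensor_funM tensor_fun_rang.

Lemma tensor_embedding_inl u : tensor_embedding (tensor_inl A S u) = g u.
Proof.
rewrite [LHS]tensor_fun_pure; have [-> _] := residue_funM.
by rewrite mulr1.
Qed.

Lemma tensor_embedding_resolved z : resolves (n * q) c (tensor_embedding z).
Proof.
rewrite [tensor_embedding z]/(tensor_fun z) /tensor_fun /tensor_lift.
elim/big_ind: _ => [||u _]; [exact: resolves0|exact: resolvesD|].
apply: resolvesM; last exact: residue_fun_resolved.
exact: (resolves_refines cP ac).
Qed.

(** Each atom [c (i * q + j)] is the product of [a i], which lies in the image of [g], and a
    residue, hence the image of a pure tensor. *)
Lemma tensor_embedding_surj x :
    (forall x, resolves n a x -> exists u, x = g u) ->
  resolves (n * q) c x -> exists z, x = tensor_embedding z.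
Proof.
move=> g_surj; apply: (resolves_ind (P := fun x => exists z, _ = _ z) cP)
  => [|_ _ [z ->] [w ->]|k].
- by exists 0; rewrite rmorph0.
- by exists (z + w); rewrite rmorphD.
move=> /ltn_mulP[i [j [ni qj ->]]]; rewrite -(residue_mul cP ac ni qj).
have [u ->] := g_surj _ (resolves_cell aP ni).
have [y <-] := residue_fun_delta qj.
by exists (tensor_pure u y); rewrite [RHS]tensor_fun_pure.
Qed.

End Tensor.
End TensorStep.

(** * The tower of finite tensor products and its limit *)

Section Tower.
Variables (R : realType) (H : hammingType R).
Variables (p n : nat -> nat) (a : nat -> nat -> H).
Hypothesis p_gt0 : forall k, (0 < p k)%N.
Hypotheses (n0 : n 0%N = 1%N) (nS : forall k, n k.+1 = (n k * p k)%N).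
Hypothesis aP : forall k, equipartition (n k) (a k).
Hypothesis a_ref : forall k, refines (n k) (a k) (p k) (a k.+1).
Hypothesis a_res : forall x, exists k, resolves (n k) (a k) x.

Let A k : hammingType R := std_hamming (p_gt0 k).

Let acP k : equipartition (n k * p k) (a k.+1).
Proof. by rewrite -nS. Qed.

(** Stage [k] has [k + 1] tensor factors, hence the partition of index [k.+1]. Resolution is bundled
    in because the next tensor step requires it. *)
Let resolved_embedding k := {g : hamming_embedding (finite_tensor A k) H |
  forall z, resolves (n k.+1) (a k.+1) (g z)}.

Let tower0_res y :
  resolves (n 1) (a 1)
    (residue_embedding (aP 0) (acP 0) (@a_ref 0) (p_gt0 0) y).
Proof. by rewrite nS; exact: residue_fun_resolved (acP 0) (@a_ref 0) _ _. Qed.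

Let towerS_res k (g : resolved_embedding k) z : resolves (n k.+2) (a k.+2)
  (tensor_embedding (aP k.+1) (acP k.+1) (@a_ref k.+1) (p_gt0 k.+1)
    (svalP g) z).
Proof. by rewrite nS; exact: tensor_embedding_resolved. Qed.

Let tower : forall k, resolved_embedding k := fix tower k :=
  if k is k'.+1 return resolved_embedding k
  then exist _ _ (towerS_res (tower k')) else exist _ _ tower0_res.

Let tower_compat k x :
  sval (tower k.+1) (tensor_inl (finite_tensor A k) (A k.+1) x) =
  sval (tower k) x.
Proof. exact: tensor_embedding_inl. Qed.

Let tower_surj k x : resolves (n k.+1) (a k.+1) x ->
  exists z, x = sval (tower k) z.
Proof.
elim: k x => [|k IHk] x ax; rewrite nS in ax.
  exact: residue_embedding_surj n0 ax.
exact: tensor_embedding_surj IHk ax.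
Qed.

(** An [x] resolved by partition [k] is also resolved by partition [k.+1], whose sums of cells are
    all reached by stage [k] of the tower. *)
Lemma hamming_iso_infinite_tensor : hamming_iso H (infinite_tensor A).
Proof.
apply: (hamming_iso_direct_limit tower_compat) => x.
have [k ax] := a_res x; exists k; apply: tower_surj.
by rewrite nS; apply: (resolves_refines (acP k) (@a_ref k)).
Qed.

End Tower.

Local Open Scope classical_set_scope.
Local Open Scope card_scope.

Theorem theorem1 (R : realType) (H : hammingType R)
    (H_countable : [set: H] #= [set: nat])
    (H_locally_standard : locally_standard H) :
  exists (p : nat -> nat) (p_prime : forall i, prime (p i)),
    hamming_iso H (infinite_tensor
      (fun i => std_hamming (prime_gt0 (p_prime i)) : hammingType R)).
Proof.
have [h] : exists h : nat -> H, bijective h.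
  have /card_set_bijP[f] := H_countable.
  by rewrite setTT_bijective => -[h fK hK]; exists h; exists f.
move=> /(prime_refinements H_locally_standard).
move=> [p [n [a [p_prime [n0 nS] aP a_ref a_res]]]]; exists p, p_prime.
exact: hamming_iso_infinite_tensor n0 nS aP a_ref a_res.
Qed.
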